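(* For every $d\ge 2$, $$\beta_{\mathrm{TSP}}^d=\beta_{\mathrm{MST}_2}^d>\beta_{\mathrm{MST}_3}^d>\cdots>\beta_{\mathrm{MST}_{\tau'(d)}}^d=\beta_{\mathrm{MST}}^d ,$$ where $\tau'(d)$ is the strict kissing number of $\mathbb{R}^d$.
   Context: Let $x_1,x_2,\dots$ be independent uniformly random points of $[0,1]^d$ and $\mathcal{X}_n=\{x_1,\dots,x_n\}$. All lengths are Euclidean. For a finite set $X\subseteq\mathbb{R}^d$: $\mathrm{TSP}(X)$ is the minimum length of a traveling salesperson tour (closed Hamiltonian cycle) through $X$; $\mathrm{MST}(X)$ is the minimum length of a spanning tree of $X$; and for $k\ge 2$, $\mathrm{MST}_k(X)$ is the minimum length of a spanning tree of $X$ all of whose vertices have degree at most $k$. For each functional $L$ among these, $\beta_L^d$ denotes the constant such that $L(\mathcal{X}_n)/n^{(d-1)/d}\to\beta_L^d$ almost surely (these constants are known to exist). The strict kissing number $\tau'(d)$ is the maximum $K$ such that there exist $\varepsilon>0$ and a configuration in $\mathbb{R}^d$ of $K$ disjoint spheres of radius $1+\varepsilon$, each tangent to a common unit sphere. *)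

(* Defs.v *)
From HB Require Import structures.
From mathcomp Require Import all_boot all_order all_algebra.
From mathcomp Require Import finmap.
From mathcomp Require Import all_classical all_reals all_analysis.

Set Implicit Arguments.
Unset Strict Implicit.
Unset Printing Implicit Defensive.

Import Order.TTheory GRing.Theory Num.Theory numFieldNormedType.Exports.

Local Open Scope classical_set_scope.
Local Open Scope ring_scope.

(* The library norm on 'rV[R]_d is the sup norm, so the Euclidean distance is
   defined explicitly. *)
Definition eucl_dist (R : realType) (d : nat) (u v : 'rV[R]_d) : R :=
  Num.sqrt (\sum_(j < d) (u 0 j - v 0 j) ^+ 2).

(* A simple graph on a finite type is given by the set of its ordered pairs of
   adjacent vertices, so each edge occurs in it in both directions. *)
Definition simple_graph (V : finType) (E : {set V * V}) : Prop :=
  (forall u, (u, u) \notin E) /\ (forall u v, (u, v) \in E -> (v, u) \in E).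

Definition adj (V : finType) (E : {set V * V}) : rel V :=
  fun u v => (u, v) \in E.

Definition graph_connected (V : finType) (E : {set V * V}) : Prop :=
  forall u v, connect (adj E) u v.

(* Going back and forth along one edge is a closed path with two distinct
   vertices; a cycle of a simple graph has at least three. *)
Definition graph_acyclic (V : finType) (E : {set V * V}) : Prop :=
  forall c : seq V, ucycle (adj E) c -> (size c <= 2)%N.

Definition is_spanning_tree (V : finType) (E : {set V * V}) : Prop :=
  [/\ simple_graph E, graph_connected E & graph_acyclic E].

Definition degree (V : finType) (E : {set V * V}) (u : V) : nat :=
  #|[pred v | adj E u v]|.

(* The factor 1/2 compensates for each edge being listed in both directions. *)
Definition graph_length (R : realType) (d : nat) (X : {fset 'rV[R]_d})
    (E : {set X * X}) : R :=
  (\sum_(p in E) eucl_dist (val p.1) (val p.2)) / 2.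

(* In MST, MSTk and TSP the infimum ranges over a finite set of lengths, which
   is nonempty (for MSTk, as soon as 2 <= k), so it is a minimum. *)
Definition MST (R : realType) (d : nat) (X : {fset 'rV[R]_d}) : R :=
  inf [set graph_length E | E in [set E : {set X * X} | is_spanning_tree E]].

Definition MSTk (R : realType) (d k : nat) (X : {fset 'rV[R]_d}) : R :=
  inf [set graph_length E | E in [set E : {set X * X} |
         is_spanning_tree E /\ forall u, (degree E u <= k)%N]].

(* A tour is an ordering s of the points of X; next s p is the point following
   p in the cyclic order of s. *)
Definition tour_length (R : realType) (d : nat) (s : seq 'rV[R]_d) : R :=
  \sum_(p <- s) eucl_dist p (next s p).

Definition TSP (R : realType) (d : nat) (X : {fset 'rV[R]_d}) : R :=
  inf [set tour_length s | s in [set s : seq 'rV[R]_d | perm_eq s X]].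

Definition borel (R : realType) (d : nat) : set (set 'rV[R]_d) :=
  <<s [set U | open U] >>.

Definition random_points (R : realType) (d : nat) (dT : measure_display)
    (T : measurableType dT) (x : nat -> T -> 'rV[R]_d) : Prop :=
  forall i B, borel B -> measurable (x i @^-1` B).

Definition independent_points (R : realType) (d : nat) (dT : measure_display)
    (T : measurableType dT) (P : probability T R)
    (x : nat -> T -> 'rV[R]_d) : Prop :=
  forall (s : seq nat) (B : nat -> set 'rV[R]_d),
    uniq s -> (forall i, borel (B i)) ->
    P (\bigcap_(i in [set` s]) (x i @^-1` B i)) =
      (\prod_(i <- s) P (x i @^-1` B i))%E.

(* The uniform law on the unit cube is the d-fold product of the uniform law on
   the unit interval, hence is determined by its values on measurable boxes. *)
Definition uniform_points (R : realType) (d : nat) (dT : measure_display)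
    (T : measurableType dT) (P : probability T R)
    (x : nat -> T -> 'rV[R]_d) : Prop :=
  forall (i : nat) (A : 'I_d -> set (measurableTypeR R)),
    (forall j, measurable (A j)) ->
    P [set w | forall j, A j (x i w 0 j)] =
      (\prod_(j < d) uniform_prob (@ltr01 R) (A j))%E.

Definition iid_uniform (R : realType) (d : nat) (dT : measure_display)
    (T : measurableType dT) (P : probability T R)
    (x : nat -> T -> 'rV[R]_d) : Prop :=
  [/\ random_points x, independent_points P x & uniform_points P x].

(* The points are numbered from 0. *)
Definition point_set (R : realType) (d : nat) (T : Type)
    (x : nat -> T -> 'rV[R]_d) (n : nat) (w : T) : {fset 'rV[R]_d} :=
  [fset x (val i) w | i in [set: 'I_n]%SET]%fset.

Definition growth_constant (R : realType) (d : nat) (dT : measure_display)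
    (T : measurableType dT) (P : probability T R) (x : nat -> T -> 'rV[R]_d)
    (L : {fset 'rV[R]_d} -> R) (b : R) : Prop :=
  {ae P, forall w,
    (L (point_set x n w) / n%:R `^ ((d%:R - 1) / d%:R)) @[n --> \oo] --> b}.

Definition sphere (R : realType) (d : nat) (c : 'rV[R]_d) (r : R) :
    set 'rV[R]_d :=
  [set p | eucl_dist c p = r].

(* In dimension at least 2, this is tangency of two spheres.  Internal tangency
   is included, but an internally tangent sphere of radius 1 + e meets every
   other sphere of the same radius tangent to the unit sphere, so this does not
   affect kissing configurations with at least two spheres. *)
Definition tangent (R : realType) (d : nat) (S S' : set 'rV[R]_d) : Prop :=
  exists p, S `&` S' = [set p].

Definition strict_kissing_configuration (R : realType) (d K : nat) : Prop :=
  exists (e : R) (o : 'rV[R]_d) (c : 'I_K -> 'rV[R]_d),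
    [/\ 0 < e,
        trivIset [set: 'I_K] (fun i => sphere (c i) (1 + e)) &
        forall i, tangent (sphere (c i) (1 + e)) (sphere o 1)].

(* The maximum exists by a volume bound, so the default value 0 is not used. *)
Definition strict_kissing_number (R : realType) (d : nat) : nat :=
  xget 0%N [set K | strict_kissing_configuration R d K /\
    forall K', strict_kissing_configuration R d K' -> (K' <= K)%N].

(* Main.v *)
Require Import Defs.
From mathcomp Require Import all_boot all_order all_algebra.
From mathcomp Require Import finmap.
From mathcomp Require Import all_classical all_reals all_analysis.
From mathcomp Require Import measurable_realfun.
From mathcomp Require Import ring lra zify.

Set Implicit Arguments.
Unset Strict Implicit.
Unset Printing Implicit Defensive.

Import Order.TTheory GRing.Theory Num.Theory numFieldNormedType.Exports.

(** Strict inequality.  Let c be a point of the set and U a set of more than k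
    points such that, for every u in U, every point other than c and u is farther
    from u than c is, by at least g.  In a connected graph where c has degree at
    most k, some u in U is not adjacent to c; on a simple path from u to c, replace
    the first edge uz by uc.  The graph stays connected, its length decreases by at
    least g, and no degree increases except that of c, by one.  So N such centers
    give MST_(k+1) + N g <= MST_k.  For k < tau'(d), small perturbations of a
    center with k + 1 leaves in directions at pairwise angles above 60 degrees,
    isolated from the other points, provide such centers with g of the order of
    n^(-1/d), and among n random points their expected number is at least a
    constant times n.  If the two constants were equal (or in the wrong order), the
    proportion of centers would tend to 0 almost surely, hence, by dominated
    convergence, in expectation.

    Equality at tau'(d).  When the points span no isosceles triangle, the edges at a
    vertex of a minimum spanning tree make angles above 60 degrees, so its degrees
    are at most tau'(d); the general case follows by perturbing the points.

    Equality of TSP and MST_2.  A tree of maximum degree 2 is a Hamiltonian path,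
    and closing it costs at most the diameter of the cube. *)

Local Open Scope ring_scope.

(** * Spanning trees and edge exchanges *)

(** Arbitrary weights on an abstract vertex type let the same exchange lemmas serve the given points
    and their perturbations. *)
Definition wlen (R : realType) (V : finType) (w : V -> V -> R)
    (E : {set V * V}) : R :=
  (\sum_(p in E) w p.1 p.2) / 2.

Definition exchange (V : finType) (E : {set V * V}) (u z c : V) : {set V * V} :=
  ((E :\: [set (u, z); (z, u)]) :|: [set (u, c); (c, u)])%SET.

Lemma adj_sym (V : finType) (E : {set V * V}) :
  simple_graph E -> symmetric (adj E).
Proof. by move=> [_ sE] u v; apply/idP/idP => /sE. Qed.

Lemma connect_adj_sym (V : finType) (E : {set V * V}) :
  simple_graph E -> connect_sym (adj E).
Proof. by move=> sE; apply: sym_connect_sym; apply: adj_sym. Qed.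

(** A path that never visits [u] uses no edge at [u], so it survives any change of the edges at
    [u]. *)
Lemma connect_avoid (V : finType) (e e' : rel V) (u z : V) (p : seq V) :
  path e z p -> u \notin z :: p ->
  (forall a b, a != u -> b != u -> e a b -> e' a b) ->
  connect e' z (last z p).
Proof.
move=> + + H; elim: p z => [|y p IH] z //= /andP[ezy pth].
rewrite !inE !negb_or => /and3P[uz uy up].
apply: (connect_trans (y := y)).
  by apply: connect1; apply: H; rewrite // eq_sym.
by apply: IH => //; rewrite inE negb_or uy.
Qed.

Lemma in_exchange (V : finType) (E : {set V * V}) (u z c a b : V) :
  ((a, b) \in exchange E u z c) =
  [|| [&& (a, b) \in E, (a, b) != (u, z) & (a, b) != (z, u)],
      (a, b) == (u, c) | (a, b) == (c, u)].
Proof.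
by rewrite !inE negb_or; case: ((a, b) \in E); rewrite /= ?andbF ?andbT.
Qed.

Lemma exchange_simple (V : finType) (E : {set V * V}) (u z c : V) :
  simple_graph E -> u != c -> simple_graph (exchange E u z c).
Proof.
move=> [iE sE] uc; split=> [a|a b].
  rewrite in_exchange (negbTE (iE a)) /= !xpair_eqE.
  by apply/negP => /orP[] /andP[/eqP->]; rewrite ?(negbTE uc) // eq_sym (negbTE uc).
rewrite !in_exchange !xpair_eqE => /or3P[/and3P[/sE -> h1 h2]|/andP[/eqP-> /eqP->]|/andP[/eqP-> /eqP->]].
- by rewrite [(b == u) && _]andbC h2 [(b == z) && _]andbC h1.
- by rewrite !eqxx !orbT.
- by rewrite !eqxx !orbT.
Qed.

(** In the new graph [u] still reaches [z] by way of [c], so the deleted edge is bypassed and every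
    old edge keeps its ends connected. *)
Lemma exchange_connected (V : finType) (E : {set V * V}) (u z c : V) :
  simple_graph E -> graph_connected E -> u != c ->
  connect (adj (exchange E u z c)) z c -> graph_connected (exchange E u z c).
Proof.
move=> sE cE uc zc.
have sE' := exchange_simple z sE uc.
have uz : connect (adj (exchange E u z c)) u z.
  apply: (connect_trans (y := c)).
    by apply: connect1; rewrite /adj in_exchange eqxx orbT.
  by rewrite connect_adj_sym.
move=> a b; apply: (connect_sub _ (cE a b)) => {}a {}b ab.
have [/eqP[-> ->]//|abuz] := boolP ((a, b) == (u, z)).
have [/eqP[-> ->]//|abzu] := boolP ((a, b) == (z, u)).
  by rewrite connect_adj_sym.
by apply: connect1; rewrite /adj in_exchange abuz abzu [(a, b) \in E]ab.
Qed.

(** Only an inequality: [uc] may already be an edge, and for [u = c] its two orientations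
    coincide. *)
Lemma exchange_length (R : realType) (V : finType) (w : V -> V -> R)
    (E : {set V * V}) (u z c : V) :
  (forall a b, 0 <= w a b) -> (forall a b, w a b = w b a) ->
  simple_graph E -> (u, z) \in E ->
  wlen w (exchange E u z c) <= wlen w E - w u z + w u c.
Proof.
move=> w0 wC [iE sE] Euz.
have uz : u != z by apply: contraL Euz => /eqP->; apply: iE.
have Ezu := sE _ _ Euz.
have pair2 x y : \sum_(p in [set (x, y); (y, x)]%SET) w p.1 p.2 <= 2 * w x y.
  have [->|xy] := eqVneq x y.
    by rewrite finset.setUid big_set1 /=; have := w0 y y; lra.
  rewrite big_setU1 ?inE ?xpair_eqE ?(negbTE xy) //= big_set1 /= (wC y x); lra.
have -> : wlen w E = (\sum_(p in E :\: [set (u, z); (z, u)]) w p.1 p.2) / 2 + w u z.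
  rewrite /wlen (big_setID [set (u, z); (z, u)]%SET) /=.
  have -> : (E :&: [set (u, z); (z, u)] = [set (u, z); (z, u)])%SET.
    by apply/finset.setIidPr/fintype.subsetP => p; rewrite !inE => /orP[] /eqP->.
  rewrite big_setU1 ?inE ?xpair_eqE ?(negbTE uz) //= big_set1 /= (wC z u); lra.
have : \sum_(p in exchange E u z c) w p.1 p.2 <=
  \sum_(p in E :\: [set (u, z); (z, u)]) w p.1 p.2 +
  \sum_(p in [set (u, c); (c, u)]%SET) w p.1 p.2.
  rewrite [leRHS]addrC /exchange finset.setUC.
  rewrite (big_setID [set (u, c); (c, u)]%SET) /= finset.setUK lerD2l.
  rewrite finset.setDUl finset.setDv finset.set0U.
  rewrite [leRHS](big_setID [set (u, c); (c, u)]%SET) /= lerDr.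
  by apply: sumr_ge0.
have := pair2 u c; rewrite /wlen; lra.
Qed.

(** At [c] only the neighbour [u] can be new, at [u] the neighbour [z] is traded for [c], and no
    other vertex gains a neighbour. *)
Lemma exchange_degree (V : finType) (E : {set V * V}) (u z c v : V) :
  simple_graph E -> (u, z) \in E -> u != c -> z != c ->
  (degree (exchange E u z c) v <= degree E v + (v == c))%N.
Proof.
move=> [iE sE] Euz uc zc.
have uz : u != z by apply: contraL Euz => /eqP->; apply: iE.
have [->|vc] := eqVneq v c.
  rewrite /degree addn1 -add1n -(card1 u) -cardUI; apply: leq_trans (leq_addr _ _).
  apply: subset_leq_card; apply/fintype.subsetP => a; rewrite !inE /adj in_exchange !xpair_eqE !eqxx /=.
  by rewrite (eq_sym c u) (negbTE uc) /= => /orP[/andP[-> _]|->]; rewrite ?orbT.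
rewrite addn0; have [->|vu] := eqVneq v u.
  rewrite /degree (cardD1 z [pred x | adj E u x]) inE /= [adj E u z]Euz -[X in (_ <= X + _)%N](card1 c) -cardUI.
  apply: leq_trans (leq_addr _ _); apply: subset_leq_card; apply/fintype.subsetP => a.
  rewrite !inE /adj in_exchange !xpair_eqE !eqxx /= (negbTE uc) (negbTE uz) /= orbF andbT.
  by move=> /orP[/andP[-> ->]|->] //; rewrite orbT.
apply: subset_leq_card; apply/fintype.subsetP => a; rewrite !inE /adj in_exchange !xpair_eqE.
by rewrite (negbTE vc) (negbTE vu) /= orbF => /andP[].
Qed.

Lemma center_exchange (R : realType) (V : finType) (w : V -> V -> R)
    (E : {set V * V}) (k : nat) (c : V) (U : {set V}) (g : R) :
  (forall a b, 0 <= w a b) -> (forall a b, w a b = w b a) ->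
  simple_graph E -> graph_connected E ->
  (degree E c <= k)%N -> (k < #|U|)%N -> c \notin U ->
  (forall u z, u \in U -> z != c -> z != u -> w u c + g <= w u z) ->
  exists E', [/\ simple_graph E', graph_connected E', wlen w E' <= wlen w E - g
    & forall v, (degree E' v <= degree E v + (v == c))%N].
Proof.
move=> w0 wC sE cE dc kU cU H.
(* Pigeonhole: [c] has at most [k] neighbours and [U] has more than [k] elements. *)
have [u uU Euc] : exists2 u, u \in U & (u, c) \notin E.
  apply/exists_inP; apply: contraLR kU; rewrite negb_exists_in => /forall_inP UE.
  rewrite -leqNgt; apply: leq_trans dc; apply: subset_leq_card; apply/fintype.subsetP => v /UE.
  by rewrite negbK inE /adj => /sE.2.
have uc : u != c by apply: contraNneq cU => <-.
have [p pth] := connectP (cE u c).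
(* On a simple path from [u] to [c] the first edge [uz] has [z != c], and the rest avoids [u], so it
   still joins [z] to [c] after the exchange. *)
case/shortenP: pth => -[_ _ _ /= cu|z p' /= /andP[Euz pth] /andP[up _] _ clast].
  by rewrite cu eqxx in uc.
have zc : z != c by apply: contraNneq Euc => <-.
have zu : z != u by apply: contraTneq Euz => ->; apply: sE.1.
exists (exchange E u z c); split.
- exact: exchange_simple.
- apply: exchange_connected => //; rewrite [X in connect _ _ X]clast.
  apply: (connect_avoid pth up) => a b au bu ab.
  by rewrite /adj in_exchange !xpair_eqE (negbTE au) (negbTE bu) !andbF [_ \in _]ab.
- apply: (le_trans (exchange_length c w0 wC sE Euz)).
  have := H u z uU zc zu; lra.
- by move=> v; apply: exchange_degree.
Qed.

(** An exchange at one center raises no other degree, so the centers still to be treated keep degree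
    at most [k]; the condition on the weights does not mention the graph. *)
Lemma centers_exchange (R : realType) (V : finType) (w : V -> V -> R)
    (E : {set V * V}) (k : nat) (C : seq V) (U : V -> {set V}) (g : R) :
  (forall a b, 0 <= w a b) -> (forall a b, w a b = w b a) ->
  simple_graph E -> graph_connected E ->
  (forall v, degree E v <= k)%N -> uniq C ->
  (forall c, c \in C -> (k < #|U c|)%N /\ c \notin U c) ->
  (forall c u z, c \in C -> u \in U c -> z != c -> z != u -> w u c + g <= w u z) ->
  exists E', [/\ simple_graph E', graph_connected E',
    wlen w E' <= wlen w E - (size C)%:R * g
    & forall v, (degree E' v <= degree E v + (v \in C))%N].
Proof.
move=> w0 wC sE cE dE; elim: C => [|c C IH] /=.
  by exists E; split => //; [rewrite mul0r subr0|move=> v; rewrite addn0].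
move=> /andP[cC uC] HU Hw.
have [|||E1 [sE1 cE1 lE1 dE1]] := IH => //.
- by move=> a aC; apply: HU; rewrite inE aC orbT.
- by move=> a u z aC; apply: Hw; rewrite inE aC orbT.
have [kU cU] := HU c (mem_head _ _).
have dc : (degree E1 c <= k)%N.
  by apply: leq_trans (dE1 c) _; rewrite (negbTE cC) addn0.
have [|E2 [sE2 cE2 lE2 dE2]] := center_exchange w0 wC sE1 cE1 dc kU cU (g := g).
  by move=> u z; apply: Hw; rewrite mem_head.
exists E2; split => //.
- by move: lE1 lE2; rewrite -add1n natrD; lra.
- move=> v; apply: leq_trans (dE2 v) _; have := dE1 v; rewrite inE.
  by have [->|vc] := eqVneq v c; rewrite ?(negbTE cC) /=; lia.
Qed.

Lemma spanning_tree_exists (V : finType) (E : {set V * V}) :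
  simple_graph E -> graph_connected E ->
  exists2 E' : {set V * V}, E' \subset E & is_spanning_tree E'.
Proof.
have [n] := ubnP #|E|; elim: n E => // n IH E En sE cE.
have [aE|] := pselect (graph_acyclic E); first by exists E.
move=> /existsNP[c /not_implyP[/andP[cyc unq]]] /negP; rewrite -ltnNge.
case: c cyc unq => [//|x [//|y [//|z c]]] cyc unq _.
pose E' := (E :\: [set (x, y); (y, x)])%SET.
have [xyE yzE pth] : [/\ adj E x y, adj E y z & path (adj E) z (rcons c x)].
  by move: cyc => /=/and3P[-> ->].
move: unq => /= /and4P[]; rewrite !inE !negb_or => /and3P[xy xz xc] /andP[yz yc] zc uc.
have E'E : E' \subset E by apply/fintype.subsetP => p; rewrite inE => /andP[].
have E'P a b : ((a, b) \in E') = [&& (a, b) != (x, y), (a, b) != (y, x) & (a, b) \in E].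
  by rewrite !inE negb_or andbA.
have sE' : simple_graph E'.
  split=> [a|a b].
    by rewrite E'P (negbTE (sE.1 a)) !andbF.
  rewrite !E'P !xpair_eqE => /and3P[h1 h2 /sE.2 ->].
  by rewrite [_ && (a == y)]andbC h2 [_ && (a == x)]andbC h1.
have yx : connect (adj E') y x.
  apply: (connect_trans (y := z)).
    by apply: connect1; rewrite /adj E'P !xpair_eqE [y == x]eq_sym (negbTE xy) [z == x]eq_sym (negbTE xz) andbF.
  rewrite -[x in connect _ _ x](last_rcons z c x).
  apply: (connect_avoid (u := y) pth) => [|a b ay by_ ab].
    by rewrite inE mem_rcons inE !negb_or yz (eq_sym y) xy.
  by rewrite /adj E'P !xpair_eqE (negbTE ay) (negbTE by_) andbF.
have cE' : graph_connected E'.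
  move=> a b; apply: (connect_sub _ (cE a b)) => {}a {}b ab.
  have [/eqP[-> ->]//|h1] := boolP ((a, b) == (x, y)).
    by rewrite connect_adj_sym.
  have [/eqP[-> ->]//|h2] := boolP ((a, b) == (y, x)).
  by apply: connect1; rewrite /adj E'P h1 h2.
have [|E1 E1E tE1] := IH E' _ sE' cE'.
  rewrite ltnS in En; apply: leq_trans En; apply: proper_card; rewrite properE E'E /=.
  by apply/fintype.subsetPn; exists (x, y) => //; rewrite E'P eqxx.
by exists E1 => //; apply: fintype.subset_trans E'E.
Qed.

Lemma wlen_sub (R : realType) (V : finType) (w : V -> V -> R) (E E' : {set V * V}) :
  (forall a b, 0 <= w a b) -> E' \subset E -> wlen w E' <= wlen w E.
Proof.
move=> w0 E'E; rewrite ler_pM2r ?invr_gt0 ?ltr0n//.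
by rewrite [leRHS](big_setID E') /= (finset.setIidPr E'E) lerDl sumr_ge0.
Qed.

Lemma degree_sub (V : finType) (E E' : {set V * V}) v :
  E' \subset E -> (degree E' v <= degree E v)%N.
Proof.
move=> E'E; apply: subset_leq_card; apply/fintype.subsetP => a; rewrite !inE.
by apply: (fintype.subsetP E'E).
Qed.

(** * Hamiltonian cycles and paths *)

(** The condition [p.1 != p.2] removes the loop that [next] creates when [s] has a single
    element. *)
Definition cycle_graph (V : finType) (s : seq V) : {set V * V} :=
  [set p : V * V | (p.1 != p.2) && ((p.2 == next s p.1) || (p.1 == next s p.2))]%SET.

Lemma cycle_graph_simple (V : finType) (s : seq V) : simple_graph (cycle_graph s).
Proof.
by split=> [u|u v]; rewrite !inE ?eqxx //= eq_sym orbC.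
Qed.

Lemma cycle_graph_connected (V : finType) (s : seq V) :
  uniq s -> (forall v, v \in s) -> graph_connected (cycle_graph s).
Proof.
move=> us sV u v.
have := connect_cycle (cycle_next us) (sV u) (sV v).
apply: connect_sub => {}u {}v /= /eqP <-.
have [<-|uv] := eqVneq u (next s u); first exact: connect0.
by apply: connect1; rewrite /adj inE /= uv eqxx.
Qed.

Lemma cycle_graph_degree (V : finType) (s : seq V) v :
  uniq s -> (degree (cycle_graph s) v <= 2)%N.
Proof.
move=> us; apply: (@leq_trans #|pred2 (next s v) (prev s v)|).
  apply: subset_leq_card; apply/fintype.subsetP => a; rewrite !inE /adj inE /=.
  by case/andP=> _ /orP[->//|/eqP->]; rewrite prev_next // eqxx orbT.
by rewrite card2; case: (_ != _).
Qed.

(** The inequality can be strict: a tour of two points runs twice along its only edge. *)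
Lemma cycle_graph_length (R : realType) (V : finType) (w : V -> V -> R) (s : seq V) :
  (forall a b, 0 <= w a b) -> (forall a b, w a b = w b a) ->
  uniq s -> (forall v, v \in s) ->
  wlen w (cycle_graph s) <= \sum_(v <- s) w v (next s v).
Proof.
move=> w0 wC us sV.
have -> : \sum_(v <- s) w v (next s v) = \sum_v w v (next s v).
  rewrite big_uniq //=; apply: eq_bigl => v; exact: sV.
pose A := [set (v, next s v) | v in [set: V]]%SET.
pose B := [set (next s v, v) | v in [set: V]]%SET.
have sA : \sum_(p in A) w p.1 p.2 = \sum_v w v (next s v).
  rewrite big_imset /= => [|u v _ _ []//]; by apply: eq_bigl => v; rewrite inE.
have sB : \sum_(p in B) w p.1 p.2 = \sum_v w v (next s v).
  rewrite big_imset /= => [|u v _ _ []//].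
  by apply: eq_big => [v|v _]; rewrite ?inE // wC.
have sub : cycle_graph s \subset A :|: B.
  apply/fintype.subsetP => -[a b]; rewrite !inE /= => /andP[_ /orP[]/eqP ->].
    by apply/orP; left; apply/imsetP; exists a.
  by apply/orP; right; apply/imsetP; exists b.
have := wlen_sub w0 sub.
have : \sum_(p in A :|: B) w p.1 p.2 <= \sum_(p in A) w p.1 p.2 + \sum_(p in B) w p.1 p.2.
  rewrite (big_setID A) /= finset.setUK lerD2l finset.setDUl finset.setDv finset.set0U.
  by rewrite [leRHS](big_setID A) /= lerDr sumr_ge0.
rewrite sA sB /wlen; lra.
Qed.

(** A longest simple path misses no vertex: otherwise some edge [ab] leaves it. If [a] is an end of
    the path, the path extends; if not, [a] has two neighbours on the path besides [b], hence degree
    at least 3. *)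
Lemma hamiltonian_path (V : finType) (E : {set V * V}) (x0 : V) :
  simple_graph E -> graph_connected E -> (forall v, degree E v <= 2)%N ->
  exists x p, [/\ uniq (x :: p), path (adj E) x p & forall v, v \in x :: p].
Proof.
move=> sE cE dE.
pose P n := `[< exists x p, [/\ uniq (x :: p), path (adj E) x p & size p = n] >].
have exP : exists n, P n by exists 0%N; apply/asboolP; exists x0, [::].
have ubP n : P n -> (n <= #|V|)%N.
  move=> /asboolP[x [p [u _ <-]]]; have /card_uniqP := u.
  by move=> /= h; apply: ltnW; rewrite -h max_card.
case: (ex_maxnP exP ubP) => n /asboolP[x [p [uxp pth spn]]] nmax.
exists x, p; split => // v; apply: contrapT => /negP vp.
have [a [b [ap bp ab]]] : exists a b, [/\ a \in x :: p, b \notin x :: p & adj E a b].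
  apply: contrapT => H; case/negP: vp.
  have cl : fingraph.closed (adj E) [in x :: p].
    apply: (intro_closed (connect_adj_sym sE)) => a b ab ap.
    apply: contrapT => /negP bp; apply: H; by exists a, b.
  by rewrite -(closed_connect cl (cE x v)) mem_head.
have long y q : uniq (y :: q) -> path (adj E) y q -> (size q <= size p)%N.
  by move=> uq pq; rewrite spn; apply: nmax; apply/asboolP; exists y, q.
have [ax|ax] := eqVneq a x.
  have := long b (x :: p); rewrite cons_uniq bp uxp /= pth -ax adj_sym // ab => /(_ isT isT).
  by rewrite ltnn.
move: ap; rewrite inE (negbTE ax) /= => ap.
case/splitPr: ap pth uxp bp long => p1 p2; rewrite cat_path /= => /and3P[pth1 la pth2] uxp bp long.
case: p2 pth2 uxp bp long => [|c p2] pth2 uxp bp long.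
  have := long x (rcons (p1 ++ [:: a]) b).
  rewrite -cons_uniq -rcons_cons rcons_uniq bp cons_uniq uxp rcons_path cat_path /= pth1 la last_cat /= ab => /(_ isT isT).
  by rewrite size_rcons ltnn.
have := dE a; rewrite leqNgt => /negP; apply.
move: pth2 => /= /andP[ac _].
have al : adj E a (last x p1) by rewrite adj_sym.
set l := last x p1 in la al.
have lx : l \in x :: p1 by apply: mem_last.
move: uxp; rewrite -cons_uniq -cat_cons cat_uniq => /and3P[_ /hasPn dis u2].
have lac : l \notin [:: a, c & p2] by apply/negP => /dis; rewrite lx.
move: bp; rewrite -cat_cons mem_cat negb_or => /andP[bx]; rewrite !inE !negb_or => /and3P[ba bc _].
move: lac; rewrite !inE !negb_or => /and3P[la' lc _].
have lb : l != b by apply: contraNneq bx => <-.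
rewrite (_ : 3%N = size [:: l; c; b]) //.
have /card_uniqP <- : uniq [:: l; c; b] by rewrite /= !inE negb_or lc lb eq_sym bc.
apply: subset_leq_card; apply/fintype.subsetP => y; rewrite !inE.
by move=> /or3P[]/eqP->.
Qed.

Lemma path_tour_length (R : realType) (V : finType) (w : V -> V -> R)
    (E : {set V * V}) (x : V) (p : seq V) :
  (forall a b, 0 <= w a b) -> (forall a b, w a b = w b a) ->
  simple_graph E -> uniq (x :: p) -> path (adj E) x p ->
  \sum_(v <- x :: p) w v (next (x :: p) v) <= wlen w E + w (last x p) x.
Proof.
move=> w0 wC sE uxp pth; set s := x :: p.
rewrite (big_nth x) -[size s]/(size p).+1 big_nat_recr //.
have nx i : (i < size s)%N -> next s (nth x s i) = nth x p i.
  by move=> ilt; rewrite next_nth mem_nth // index_uniq.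
(* The index [size p] is past the end of [p], and the default [x] is the cyclic successor of the
   last vertex. *)
rewrite nx ?ltnSn // (nth_default _ (leqnn _)).
rewrite -[nth x s _]/(nth x s (size s).-1) nth_last /= lerD2r.
pose f := nth x s.
have -> : \sum_(0 <= i < size p) w (nth x s i) (next s (nth x s i)) =
    \sum_(i < size p) w (f i) (f i.+1).
  rewrite big_mkord; apply: eq_bigr => i _; rewrite nx //= ltnS ltnW //.
(* [h] lists both orientations of each path edge. It is injective because the path is simple, so
   these pairs account for a part of the sum over [E]. *)
pose h (q : 'I_(size p) * bool) :=
  if q.2 then (f q.1, f q.1.+1) else (f q.1.+1, f q.1).
have nu i j : (i < size s)%N -> (j < size s)%N -> f i = f j -> i = j.
  by move=> il jl /eqP; rewrite nth_uniq // => /eqP.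
have hinj : injective h.
  move=> [i b] [j b']; rewrite /h /=.
  have [is1 js1] : (i < size s)%N /\ (j < size s)%N by split; apply: ltnW; rewrite /= ltnS.
  have [is2 js2] : (i.+1 < size s)%N /\ (j.+1 < size s)%N by rewrite !ltnS.
  case: b; case: b' => -[] /nu h1 /nu h2.
  - by congr (_, _); apply: val_inj; apply: h1.
  - by have := h1 is1 js2; have := h2 is2 js1; lia.
  - by have := h1 is2 js1; have := h2 is1 js2; lia.
  - by congr (_, _); apply: val_inj; apply: h2.
rewrite /wlen ler_pdivlMr ?ltr0n//.
have hE : [set h q | q in [set: 'I_(size p) * bool]]%SET \subset E.
  apply/fintype.subsetP => _ /imsetP[[i b] _ ->]; rewrite /h /=.
  have Ei : (f i, f i.+1) \in E by have /(pathP x) := pth; apply.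
  by case: b => //; apply: sE.2.
rewrite (big_setID [set h q | q in [set: 'I_(size p) * bool]]%SET) /= (finset.setIidPr hE).
rewrite big_imset /=; last by move=> ? ? _ _ /hinj.
have -> : \sum_(i in [set: 'I_(size p) * bool]) w (h i).1 (h i).2 =
   \sum_(i < size p) \sum_(b : bool) w (h (i, b)).1 (h (i, b)).2.
  rewrite pair_bigA /=; by apply: eq_big => [q|[i b]]; rewrite ?inE.
rewrite mulr_suml -[leLHS]addr0; apply: lerD; last exact: sumr_ge0.
apply: ler_sum => i _; rewrite big_bool /h /= (wC (f i.+1)); lra.
Qed.

(** * Euclidean distance *)

Definition dot (R : realType) (d : nat) (u v : 'rV[R]_d) : R :=
  \sum_(j < d) u 0 j * v 0 j.

Lemma dotC (R : realType) (d : nat) (u v : 'rV[R]_d) : dot u v = dot v u.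
Proof. by apply: eq_bigr => j _; rewrite mulrC. Qed.

Lemma dotDl (R : realType) (d : nat) (u v w : 'rV[R]_d) :
  dot (u + v) w = dot u w + dot v w.
Proof. by rewrite -big_split; apply: eq_bigr => j _; rewrite mxE mulrDl. Qed.

Lemma dotZl (R : realType) (d : nat) a (u v : 'rV[R]_d) :
  dot (a *: u) v = a * dot u v.
Proof. by rewrite /dot mulr_sumr; apply: eq_bigr => j _; rewrite mxE mulrA. Qed.

Lemma dotNl (R : realType) (d : nat) (u v : 'rV[R]_d) : dot (- u) v = - dot u v.
Proof. by rewrite -scaleN1r dotZl mulN1r. Qed.

Lemma dotBl (R : realType) (d : nat) (u v w : 'rV[R]_d) :
  dot (u - v) w = dot u w - dot v w.
Proof. by rewrite dotDl dotNl. Qed.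

Lemma dotDr (R : realType) (d : nat) (u v w : 'rV[R]_d) :
  dot w (u + v) = dot w u + dot w v.
Proof. by rewrite dotC dotDl !(dotC w). Qed.

Lemma dotBr (R : realType) (d : nat) (u v w : 'rV[R]_d) :
  dot w (u - v) = dot w u - dot w v.
Proof. by rewrite dotC dotBl !(dotC w). Qed.

Lemma dotZr (R : realType) (d : nat) a (u v : 'rV[R]_d) :
  dot v (a *: u) = a * dot v u.
Proof. by rewrite dotC dotZl dotC. Qed.

Lemma dotNr (R : realType) (d : nat) (u v : 'rV[R]_d) : dot v (- u) = - dot v u.
Proof. by rewrite dotC dotNl dotC. Qed.

Definition dotE := (dotDl, dotDr, dotBl, dotBr, dotZl, dotZr, dotNl, dotNr).

Lemma dot_sub (R : realType) (d : nat) (u v : 'rV[R]_d) :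
  dot (u - v) (u - v) = dot u u - 2 * dot u v + dot v v.
Proof. by rewrite !dotE (dotC v u); ring. Qed.

Lemma dot_ge0 (R : realType) (d : nat) (u : 'rV[R]_d) : 0 <= dot u u.
Proof. by apply: sumr_ge0 => j _; rewrite -expr2 sqr_ge0. Qed.

Lemma dot_eq0 (R : realType) (d : nat) (u : 'rV[R]_d) : (dot u u == 0) = (u == 0).
Proof.
apply/eqP/eqP => [u0|->]; last by rewrite /dot big1 // => j _; rewrite mxE mul0r.
apply/rowP => j; rewrite mxE.
have pos i : true -> 0 <= u 0 i * u 0 i by rewrite -expr2 sqr_ge0.
have /eqP := psumr_eq0P pos u0 (erefl (xpredT j)).
by rewrite mulf_eq0 orbb => /eqP.
Qed.

Lemma eucl_distE (R : realType) (d : nat) (u v : 'rV[R]_d) :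
  eucl_dist u v = Num.sqrt (dot (u - v) (u - v)).
Proof. by congr Num.sqrt; apply: eq_bigr => j _; rewrite !mxE expr2. Qed.

Lemma sqr_eucl_dist (R : realType) (d : nat) (u v : 'rV[R]_d) :
  eucl_dist u v ^+ 2 = dot (u - v) (u - v).
Proof. by rewrite eucl_distE sqr_sqrtr // dot_ge0. Qed.

Lemma eucl_dist_ge0 (R : realType) (d : nat) (u v : 'rV[R]_d) : 0 <= eucl_dist u v.
Proof. exact: sqrtr_ge0. Qed.

Lemma eucl_distC (R : realType) (d : nat) (u v : 'rV[R]_d) :
  eucl_dist u v = eucl_dist v u.
Proof. by rewrite !eucl_distE -opprB dotNl dotNr opprK. Qed.

(** For nonzero [v], the square of [dot v v *: u - dot u v *: v] is [dot v v] times the difference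
    of the two sides. *)
Lemma cauchy_schwarz (R : realType) (d : nat) (u v : 'rV[R]_d) :
  dot u v ^+ 2 <= dot u u * dot v v.
Proof.
have [->|v0] := eqVneq v 0.
  have -> : (0 : 'rV[R]_d) = 0 *: 0 by rewrite scale0r.
  by rewrite !dotE; lra.
have vv : 0 < dot v v by rewrite lt0r dot_eq0 v0 dot_ge0.
have := dot_ge0 (dot v v *: u - dot u v *: v).
rewrite !dotE (dotC v u) => H.
have : 0 <= dot v v * (dot u u * dot v v - dot u v ^+ 2) by lra.
by rewrite pmulr_rge0 // subr_ge0.
Qed.

Lemma eucl_dist_triangle (R : realType) (d : nat) (u v w : 'rV[R]_d) :
  eucl_dist u w <= eucl_dist u v + eucl_dist v w.
Proof.
have a0 := eucl_dist_ge0 u v; have b0 := eucl_dist_ge0 v w.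
rewrite -(ler_pXn2r (ltn0Sn 1)) ?nnegrE ?eucl_dist_ge0 ?addr_ge0 //.
have : dot (u - v) (v - w) <= eucl_dist u v * eucl_dist v w.
  rewrite (le_trans (ler_norm _)) //.
  rewrite -(ler_pXn2r (ltn0Sn 1)) ?nnegrE ?mulr_ge0 //.
  by rewrite real_normK ?num_real // exprMn !sqr_eucl_dist cauchy_schwarz.
rewrite sqrrD !sqr_eucl_dist.
have -> : dot (u - w) (u - w) = dot (u - v) (u - v) + 2 * dot (u - v) (v - w) + dot (v - w) (v - w).
  by rewrite !dotE (dotC v u) (dotC w u) (dotC w v); ring.
lra.
Qed.

Lemma eucl_dist_eq (R : realType) (d : nat) (u v : 'rV[R]_d) (r : R) :
  0 <= r -> eucl_dist u v = r <-> dot (u - v) (u - v) = r ^+ 2.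
Proof.
move=> r0; rewrite -sqr_eucl_dist; split=> [->//|/eqP].
by rewrite eqrXn2 ?eucl_dist_ge0 // => /eqP.
Qed.

Lemma coord_le_eucl_dist (R : realType) (d : nat) (u v : 'rV[R]_d) j :
  `|u 0 j - v 0 j| <= eucl_dist u v.
Proof.
rewrite -(ler_pXn2r (ltn0Sn 1)) ?nnegrE ?eucl_dist_ge0 // real_normK ?num_real //.
rewrite sqr_eucl_dist /dot (bigD1 j) //= !mxE expr2 lerDl sumr_ge0 // => i _.
by rewrite -expr2 sqr_ge0.
Qed.

Lemma eucl_dist_le_coord (R : realType) (d : nat) (u v : 'rV[R]_d) (r : R) :
  (forall j, `|u 0 j - v 0 j| <= r) -> eucl_dist u v <= d%:R * r.
Proof.
case: d u v => [|d] u v H.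
  by rewrite /eucl_dist big_ord0 sqrtr0 mul0r.
have r0 : 0 <= r by apply: le_trans (H 0).
rewrite -(ler_pXn2r (ltn0Sn 1)) ?nnegrE ?eucl_dist_ge0 ?mulr_ge0 //.
rewrite sqr_eucl_dist; apply: (@le_trans _ _ (\sum_(j < d.+1) r ^+ 2)).
  apply: ler_sum => j _; rewrite !mxE -expr2.
  by rewrite -[leLHS]real_normK ?num_real // ler_pXn2r ?nnegrE.
rewrite sumr_const card_ord -[leLHS]mulr_natl exprMn.
apply: ler_wpM2r; first by rewrite exprn_ge0.
by rewrite expr2 ler_peMl ?ler1n.
Qed.

(** * Strict kissing configurations *)

(** Unit vectors at pairwise angles above 60 degrees: the directions of the centres in a strict
    kissing configuration. *)
Definition separated_directions (R : realType) (d K : nat) (u : 'I_K -> 'rV[R]_d) : Prop :=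
  (forall i, dot (u i) (u i) = 1) /\ (forall i j, i != j -> dot (u i) (u j) < 1 / 2).

Lemma finite_gap (R : realType) (I : finType) (P : pred I) (f : I -> R) (b : R) :
  (forall i, P i -> f i < b) -> exists2 e, 0 < e & forall i, P i -> f i <= b - e.
Proof.
move=> fb.
have [e e0 He] : exists2 e, 0 < e & forall i, i \in enum I -> P i -> f i <= b - e.
  elim: (enum I) => [|x s [e e0 He]]; first by exists 1.
  have [Px|nPx] := boolP (P x).
    exists (Num.min e (b - f x)) => [|i]; first by rewrite lt_min e0 subr_gt0 fb.
    have m1 : Num.min e (b - f x) <= e by rewrite ge_min lexx.
    have m2 : Num.min e (b - f x) <= b - f x by rewrite ge_min lexx orbT.
    by rewrite inE => /orP[/eqP->|/He h /h]; lra.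
  exists e => // i; rewrite inE => /orP[/eqP->|/He //]; by rewrite (negbTE nPx).
by exists e => // i; apply: He; rewrite mem_enum.
Qed.

Lemma separated_directions_gap (R : realType) (d K : nat) (u : 'I_K -> 'rV[R]_d) :
  separated_directions u -> exists2 m, 0 < m & forall i j, i != j -> dot (u i) (u j) <= 1 / 2 - m.
Proof.
move=> [_ uu].
have [m m0 H] := @finite_gap R ('I_K * 'I_K)%type (fun p => p.1 != p.2)
  (fun p => dot (u p.1) (u p.2)) (1 / 2) (fun p => uu p.1 p.2).
by exists m => // i j; apply: (H (i, j)).
Qed.

(** The margin [m] serves as the excess radius. Centres at distance [2 + m] from the origin have
    mutual squared distance at least [(2 + m) ^+ 2 * (1 + 2 * m)], which exceeds
    [(2 + 2 * m) ^+ 2]. *)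
Lemma separated_directions_kissing (R : realType) (d K : nat) (u : 'I_K -> 'rV[R]_d) :
  separated_directions u -> strict_kissing_configuration R d K.
Proof.
move=> au; have [m m0 H] := separated_directions_gap au; case: au => u1 _.
exists m, 0, (fun i => (2 + m) *: u i); split => //.
  move=> i j _ _ [p [/= pi pj]]; apply: contrapT => /eqP ij.
  have := eucl_dist_triangle ((2 + m) *: u i) p ((2 + m) *: u j).
  rewrite pi (eucl_distC p) pj => tr.
  have : eucl_dist ((2 + m) *: u i) ((2 + m) *: u j) ^+ 2 <= ((1 + m) + (1 + m)) ^+ 2.
    by rewrite ler_pXn2r ?nnegrE ?eucl_dist_ge0 //; lra.
  rewrite sqr_eucl_dist !dotE !u1 (dotC (u j)).
  have := H i j ij; nra.
move=> i; exists (u i); rewrite eqEsubset; split => p /=.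
  move=> [/eucl_dist_eq-/(_ ltac:(lra)) cp /eucl_dist_eq-/(_ ler01)].
  rewrite sub0r dotNl dotNr opprK expr1n => pp.
  move: cp; rewrite !dotE u1 pp (dotC p) => cp.
  have up : dot (u i) p = 1.
    have : (2 + m) * (dot (u i) p - 1) = 0 by lra.
    by move/eqP; rewrite mulf_eq0 => /orP[|] /eqP; lra.
  apply/eqP; rewrite -subr_eq0 -dot_eq0 !dotE u1 pp (dotC p) up; apply/eqP; lra.
move=> ->; split; apply/eucl_dist_eq; rewrite ?ler01 //; first by lra.
  by rewrite !dotE !u1; ring.
by rewrite sub0r dotNl dotNr opprK u1 expr1n.
Qed.

Lemma tangent_dist (R : realType) (d : nat) (c o : 'rV[R]_d) (e : R) :
  0 < e -> tangent (sphere c (1 + e)) (sphere o 1) ->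
  eucl_dist c o = e \/ eucl_dist c o = 2 + e.
Proof.
move=> e0 [p pE].
have [/= /eucl_dist_eq-/(_ ltac:(lra)) cp /eucl_dist_eq-/(_ ler01) op] :
  (sphere c (1 + e) `&` sphere o 1)%classic p by rewrite pE.
have D0 := eucl_dist_ge0 c o.
have sD := sqr_eucl_dist c o.
set D := eucl_dist c o in D0 sD *.
have [w wE] : exists w, w = c - o by exists (c - o).
have [q qE] : exists q, q = p - o by exists (p - o).
have cpE : c - p = w - q by rewrite wE qE opprB addrA subrK.
have opE : o - p = - q by rewrite qE opprB.
rewrite -wE in sD.
rewrite cpE !dotE (dotC q) -sD in cp.
rewrite opE !dotE opprK expr1n in op.
rewrite op in cp.
(* Concentric spheres of radii [1 + e] and 1 do not meet. *)
have [D00|Dn0] := eqVneq D 0.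
  have w0 : w = 0 by apply/eqP; rewrite -dot_eq0 -sD D00 expr0n.
  have wq : dot w q = 0 by rewrite w0 -(scale0r 0) dotZl mul0r.
  by rewrite D00 wq in cp; nra.
have D2 : D ^+ 2 != 0 by rewrite expf_eq0 negb_and Dn0 orbT.
(* The reflection of p across the line of centres lies on both spheres, so p is on that line. *)
have [a aE] : exists a, a * D ^+ 2 = dot w q.
  by exists (dot w q / D ^+ 2); rewrite mulfVK.
have [q' q'E] : exists q', q' = (2 * a) *: w - q by eexists.
have wq' : dot w q' = dot w q by rewrite q'E !dotE -sD; lra.
have qq' : dot q' q' = 1.
  rewrite q'E !dotE -sD op (dotC q); rewrite -aE; ring.
have : (sphere c (1 + e) `&` sphere o 1)%classic (o + q').
  split; apply/eucl_dist_eq; rewrite ?ler01 //; first by lra.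
    have -> : c - (o + q') = w - q' by rewrite wE opprD addrA.
    by rewrite !dotE -sD qq' (dotC q') wq' -cp.
  by rewrite opprD addrA subrr sub0r !dotE opprK qq' expr1n.
rewrite pE /= => q'p.
have qa : q = a *: w.
  have q'q : q' = q by rewrite qE -q'p addrC addKr.
  move: q'E; rewrite q'q => {}q'E; apply/rowP => j.
  by move: (congr1 (fun v : 'rV_d => v 0 j) q'E); rewrite !mxE; lra.
have a1 : a ^+ 2 * D ^+ 2 = 1 by rewrite -op qa !dotE -sD; ring.
have : (a * D - 1) * (a * D + 1) = 0 by lra.
rewrite -aE in cp.
(* If [a * D = 1], the common point lies on the side of [c] and the tangency is external; if
   [a * D = -1], it lies on the opposite side and the tangency is internal. *)
move=> /eqP; rewrite mulf_eq0 => /orP[]/eqP aD.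
  have : (D - (2 + e)) * (D + e) = 0.
    have -> : (D - (2 + e)) * (D + e) = D ^+ 2 - 2 * D - 2 * e - e ^+ 2 by ring.
    have : a * D ^+ 2 = D by rewrite expr2 mulrA; nra.
    nra.
  by move=> /eqP; rewrite mulf_eq0 => /orP[]/eqP; lra.
have : (D - e) * (D + (2 + e)) = 0.
  have -> : (D - e) * (D + (2 + e)) = D ^+ 2 + 2 * D - 2 * e - e ^+ 2 by ring.
  have : a * D ^+ 2 = - D by rewrite expr2 mulrA; nra.
  nra.
by move=> /eqP; rewrite mulf_eq0 => /orP[]/eqP; lra.
Qed.

(** From the first two coordinates (a, b) of [u] take (b, -a), or (0, 1) when b vanishes, and
    normalize. With [u = 0] this just supplies a unit vector. *)
Lemma orthogonal_unit (R : realType) (d : nat) (u : 'rV[R]_d) :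
  (2 <= d)%N -> exists2 v, dot v v = 1 & dot u v = 0.
Proof.
case: d u => [//|[//|d]] u _.
have sum2 (f : 'I_d.+2 -> R) : (forall j : 'I_d, f (lift ord0 (lift ord0 j)) = 0) ->
    \sum_j f j = f ord0 + f (lift ord0 ord0).
  move=> f0; rewrite !big_ord_recl /= big1 ?addr0 // => i _; exact: f0.
suff [v [vn0 uv]] : exists v : 'rV[R]_d.+2, v != 0 /\ dot u v = 0.
  have vv : 0 < dot v v by rewrite lt0r dot_eq0 vn0 dot_ge0.
  exists ((Num.sqrt (dot v v))^-1 *: v); rewrite !dotE ?uv ?mulr0 //.
  rewrite mulrA -invfM -expr2 sqr_sqrtr ?ltW // mulVf //; exact: lt0r_neq0.
pose a := u 0 ord0; pose b := u 0 (lift ord0 ord0).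
pose v (s t : R) : 'rV[R]_d.+2 := \row_j (if j == ord0 then s else if j == lift ord0 ord0 then t else 0).
have v0 s t : v s t 0 ord0 = s by rewrite mxE eqxx.
have v1 s t : v s t 0 (lift ord0 ord0) = t by rewrite mxE.
have dv s t : dot u (v s t) = a * s + b * t.
  by rewrite /dot sum2 ?v0 ?v1 // => j; rewrite mxE /= mulr0.
have [b0|bn0] := eqVneq b 0.
  exists (v 0 1); split; last by rewrite dv b0; ring.
  by apply/eqP => /rowP /(_ (lift ord0 ord0)); rewrite v1 mxE => /eqP; rewrite oner_eq0.
exists (v b (- a)); split; last by rewrite dv; ring.
by apply/eqP => /rowP /(_ ord0); rewrite v0 mxE => /eqP; rewrite (negbTE bn0).
Qed.

(** If the centres are within [2 * r], moving from their midpoint orthogonally to [a - b] by the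
    height of the isosceles triangle reaches a common point; the orthogonal direction exists because
    [2 <= d]. *)
Lemma disjoint_spheres_dist (R : realType) (d : nat) (a b : 'rV[R]_d) (r : R) :
  (2 <= d)%N -> 0 <= r -> (sphere a r `&` sphere b r)%classic = set0 ->
  2 * r < eucl_dist a b.
Proof.
move=> d2 r0 dis; rewrite ltNge; apply/negP => le.
have [v vv uv] := orthogonal_unit (a - b) d2.
have D0 := eucl_dist_ge0 a b; have sD := sqr_eucl_dist a b.
set D := eucl_dist a b in le D0 sD.
have h0 : 0 <= r ^+ 2 - D ^+ 2 / 4 by nra.
have hE := sqr_sqrtr h0; set h := Num.sqrt _ in hE *.
pose p := b + (1 / 2) *: (a - b) + h *: v.
suff : (sphere a r `&` sphere b r)%classic p by rewrite dis.
have ap : a - p = (1 / 2) *: (a - b) - h *: v.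
  by apply/rowP => j; rewrite !mxE; field.
have bp : b - p = - ((1 / 2) *: (a - b) + h *: v).
  by apply/rowP => j; rewrite !mxE; ring.
split; apply/eucl_dist_eq => //; [rewrite ap | rewrite bp];
  move: (a - b) uv sD => w uv sD; rewrite !dotE (dotC v) uv vv -sD; lra.
Qed.

Lemma kissing_separated_directions (R : realType) (d K : nat) :
  (2 <= d)%N -> (2 <= K)%N -> strict_kissing_configuration R d K ->
  exists u : 'I_K -> 'rV[R]_d, separated_directions u.
Proof.
move=> d2 K2 [e [ o [c [e0 tri tan]]]].
have far i j : i != j -> 2 * (1 + e) < eucl_dist (c i) (c j).
  move=> ij; apply: disjoint_spheres_dist => //; first by lra.
  apply: contrapT => /eqP/set0P ne; move/eqP: ij; apply; exact: tri.
(* Internal tangency is excluded by a second sphere: the two centres would be within [e + (2 + e)]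
   of each other, against [far]. *)
have cD i : eucl_dist (c i) o = 2 + e.
  have [j ij] : exists j, i != j.
    have [i0|i0] := eqVneq (val i) 0%N.
      by exists (Ordinal K2); rewrite -val_eqE /= i0.
    by exists (Ordinal (ltnW K2)); rewrite -val_eqE.
  have := eucl_dist_triangle (c i) o (c j); have := far i j ij.
  rewrite (eucl_distC o).
  by case: (tangent_dist e0 (tan i)) (tangent_dist e0 (tan j)) => -> [] ->; lra.
have cc i : dot (c i - o) (c i - o) = (2 + e) ^+ 2 by rewrite -sqr_eucl_dist cD.
exists (fun i => (2 + e)^-1 *: (c i - o)); split=> [i|i j ij].
  rewrite !dotZl !dotZr cc; field; apply/eqP; lra.

have : (2 * (1 + e)) ^+ 2 < eucl_dist (c i) (c j) ^+ 2.
  by rewrite ltr_pXn2r ?nnegrE ?eucl_dist_ge0 ?far //; lra.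
rewrite sqr_eucl_dist.
have -> : c i - c j = (c i - o) - (c j - o) by rewrite opprB addrA subrK.
rewrite dot_sub !cc dotZl dotZr => lt.
have e2 : 0 < (2 + e) ^+ 2 by rewrite exprn_gt0 //; lra.
rewrite mulrA -invfM -expr2 mulrC ltr_pdivrMr //; nra.
Qed.

Lemma kissing_mono (R : realType) (d K K' : nat) :
  (K' <= K)%N -> strict_kissing_configuration R d K ->
  strict_kissing_configuration R d K'.
Proof.
move=> le [e [ o [c [e0 tri tan]]]].
exists e, o, (fun i => c (widen_ord le i)); split => // i j _ _ /tri h.
by apply: val_inj; have := h I I => /(congr1 val).
Qed.

(* Separated points of the cube [-1, 1]^d lie in distinct cells of a grid of mesh 1/d. *)
Lemma separated_directions_bound (R : realType) (d K : nat) (u : 'I_K -> 'rV[R]_d) :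
  (0 < d)%N -> separated_directions u -> (K <= (d.*2.+1) ^ d)%N.
Proof.
move=> d0 [u1 uu].
have dR : 0 < d%:R :> R by rewrite ltr0n.
have ub i j : -1 <= u i 0 j <= 1.
  have : u i 0 j ^+ 2 <= 1.
    rewrite -(u1 i) /dot (bigD1 j) //= expr2 lerDl sumr_ge0 // => l _.
    by rewrite -expr2 sqr_ge0.
  nra.
have cell i j : 0 <= (u i 0 j + 1) * d%:R <= 2 * d%:R.
  have /andP[h1 h2] := ub i j; apply/andP; split; first by apply: mulr_ge0; lra.
  by rewrite ler_pM2r //; lra.
have cellP i j : (Num.truncn ((u i 0 j + 1) * d%:R)%R < d.*2.+1)%N.
  rewrite ltnS -(ler_nat R) -mul2n natrM.
  have /andP[h1 h2] := cell i j.
  by apply: le_trans h2; rewrite truncn_le.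
pose f i : {ffun 'I_d -> 'I_(d.*2.+1)} := [ffun j => Ordinal (cellP i j)].
have finj : injective f.
  move=> i i' ff; apply: contrapT => /eqP ii'.
  have close j : `|u i 0 j - u i' 0 j| <= d%:R^-1.
    have : (f i j : nat) = f i' j by rewrite ff.
    rewrite !ffunE /= => e.
    have /andP[a1 _] := cell i j; have /andP[b1 _] := cell i' j.
    have /andP[a2 a3] := truncn_itv a1; have /andP[b2 b3] := truncn_itv b1.
    rewrite e in a2 a3; rewrite -natr1 in a3; rewrite -natr1 in b3.
    rewrite -(ler_pM2r dR) mulVf ?lt0r_neq0 // -[X in _ * X]gtr0_norm // -normrM ler_norml.
    rewrite mulrBl; lra.
  have := @eucl_dist_le_coord _ _ (u i) (u i') _ close.
  rewrite mulfV ?lt0r_neq0 // => le1.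
  have : eucl_dist (u i) (u i') ^+ 2 <= 1 by rewrite expr_le1 ?eucl_dist_ge0.
  rewrite sqr_eucl_dist dot_sub !u1; have := uu i i' ii'; lra.
by have := leq_card f finj; rewrite card_ffun !card_ord.
Qed.

(** Configurations of at least two spheres are bounded through their directions, smaller ones
    trivially, and the empty one exists; so the maximum is attained and [xget] does not fall back on
    its default. *)
Lemma strict_kissing_numberP (R : realType) (d : nat) : (2 <= d)%N ->
  strict_kissing_configuration R d (strict_kissing_number R d) /\
  forall K, strict_kissing_configuration R d K -> (K <= strict_kissing_number R d)%N.
Proof.
move=> d2.
pose P K := `[< strict_kissing_configuration R d K >].
have exP : exists K, P K.
  exists 0%N; apply/asboolP.
  by apply: (@separated_directions_kissing R d 0 (fun=> 0)); split=> -[].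
have ubP K : P K -> (K <= d.*2.+1 ^ d)%N.
  move=> /asboolP c; have [K2|] := leqP 2 K.
    have [u au] := kissing_separated_directions d2 K2 c.
    by apply: (separated_directions_bound _ au); apply: ltnW.
  rewrite ltnS => K1; apply: leq_trans K1 _; by rewrite expn_gt0.
apply: (@xgetPex _ 0%N (fun K => strict_kissing_configuration R d K /\
  forall K', strict_kissing_configuration R d K' -> (K' <= K)%N)).
case: (ex_maxnP exP ubP) => K /asboolP cK Kmax; exists K; split => // K' cK'.
by apply: Kmax; apply/asboolP.
Qed.

(** Two opposite unit vectors are separated directions. *)
Lemma strict_kissing_number_ge2 (R : realType) (d : nat) : (2 <= d)%N ->
  (2 <= strict_kissing_number R d)%N.
Proof.
move=> d2; have [_] := strict_kissing_numberP R d2; apply.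
have [v vv _] := @orthogonal_unit R d 0 d2.
apply: (@separated_directions_kissing R d 2 (fun i : 'I_2 => if i == ord0 then v else - v)); split=> [i|i j].
  by case: ifP; rewrite ?dotNl ?dotNr ?opprK.
case: i => -[|[|//]] i; case: j => -[|[|//]] j //= _; rewrite ?dotNr ?dotNl vv; lra.
Qed.

(** * Deterministic comparison of the functionals *)

Definition fset_dist (R : realType) (d : nat) (X : {fset 'rV[R]_d}) (a b : X) : R :=
  eucl_dist (val a) (val b).

Lemma fset_dist_ge0 (R : realType) (d : nat) (X : {fset 'rV[R]_d}) (a b : X) :
  0 <= fset_dist a b.
Proof. exact: eucl_dist_ge0. Qed.

Lemma fset_distC (R : realType) (d : nat) (X : {fset 'rV[R]_d}) (a b : X) :
  fset_dist a b = fset_dist b a.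
Proof. exact: eucl_distC. Qed.

Lemma graph_length_ge0 (R : realType) (d : nat) (X : {fset 'rV[R]_d}) (E : {set X * X}) :
  0 <= graph_length E.
Proof. by rewrite divr_ge0 // sumr_ge0 // => p _; apply: eucl_dist_ge0. Qed.

Lemma graph_lengthE (R : realType) (d : nat) (X : {fset 'rV[R]_d}) (E : {set X * X}) :
  graph_length E = wlen (@fset_dist R d X) E.
Proof. by []. Qed.

(** Any connected graph contains a spanning tree, which is no longer and has no larger degrees.
    Hence exchanges need only preserve connectedness, not acyclicity. *)
Lemma MSTk_le (R : realType) (d k : nat) (X : {fset 'rV[R]_d}) (E : {set X * X}) :
  simple_graph E -> graph_connected E -> (forall v, degree E v <= k)%N ->
  MSTk k X <= graph_length E.
Proof.
move=> sE cE dE; have [E' E'E tE'] := spanning_tree_exists sE cE.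
apply: (@le_trans _ _ (graph_length E')).
  apply: ge_inf; first by exists 0 => _ [F _ <-]; apply: graph_length_ge0.
  by exists E' => //; split => // u; apply: leq_trans (degree_sub u E'E) (dE u).
exact: (wlen_sub (@fset_dist_ge0 _ _ X)).
Qed.

Lemma MST_le (R : realType) (d : nat) (X : {fset 'rV[R]_d}) (E : {set X * X}) :
  is_spanning_tree E -> MST X <= graph_length E.
Proof.
move=> tE; apply: ge_inf; last by exists E.
by exists 0 => _ [F _ <-]; apply: graph_length_ge0.
Qed.

Lemma bounded_degree_tree_exists (V : finType) (k : nat) : (2 <= k)%N ->
  exists E : {set V * V}, is_spanning_tree E /\ forall u, (degree E u <= k)%N.
Proof.
move=> k2; have [||E sub tE] := @spanning_tree_exists V (cycle_graph (enum V)).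
- exact: cycle_graph_simple.
- by apply: cycle_graph_connected => [|v]; rewrite ?enum_uniq ?mem_enum.
exists E; split => // u; apply: leq_trans (degree_sub u sub) _.
by apply: leq_trans (cycle_graph_degree u (enum_uniq _)) _.
Qed.

(** The assumption [2 <= k] makes the set of lengths nonempty, so that its infimum is a greatest
    lower bound. *)
Lemma MSTk_ge (R : realType) (d k : nat) (X : {fset 'rV[R]_d}) (b : R) :
  (2 <= k)%N ->
  (forall E : {set X * X}, is_spanning_tree E -> (forall u, degree E u <= k)%N ->
    b <= graph_length E) ->
  b <= MSTk k X.
Proof.
move=> k2 H; apply: lb_le_inf; last by move=> _ [E [tE dE] <-]; apply: H.
by have [E hE] := @bounded_degree_tree_exists X k k2; exists (graph_length E), E.
Qed.

Lemma MST_ge (R : realType) (d : nat) (X : {fset 'rV[R]_d}) (b : R) :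
  (forall E : {set X * X}, is_spanning_tree E -> b <= graph_length E) -> b <= MST X.
Proof.
move=> H; apply: lb_le_inf; last by move=> _ [E tE <-]; apply: H.
have [E [tE _]] := @bounded_degree_tree_exists X 2 isT.
by exists (graph_length E), E.
Qed.

Lemma MSTk_centers (R : realType) (d k : nat) (X : {fset 'rV[R]_d}) (C : seq X)
    (U : X -> {set X}) (g : R) :
  (2 <= k)%N -> uniq C ->
  (forall c, c \in C -> (k < #|U c|)%N /\ c \notin U c) ->
  (forall c u z, c \in C -> u \in U c -> z != c -> z != u ->
    fset_dist u c + g <= fset_dist u z) ->
  MSTk k.+1 X + (size C)%:R * g <= MSTk k X.
Proof.
move=> k2 uC UC Hg; apply: MSTk_ge => // E [sE cE _] dE.
have [E' [sE' cE' lE' dE']] := centers_exchange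
  (@fset_dist_ge0 _ _ X) (@fset_distC _ _ X) sE cE dE uC UC Hg.
have : MSTk k.+1 X <= graph_length E'.
  apply: MSTk_le => // v; apply: leq_trans (dE' v) _.
  by apply: leq_trans (leq_add (dE v) (leq_b1 _)) _; rewrite addn1.
move: lE'; rewrite !graph_lengthE; lra.
Qed.

(** * Tours and Hamiltonian paths *)

Lemma tour_length_map (R : realType) (d : nat) (X : {fset 'rV[R]_d}) (t : seq X) :
  uniq t -> tour_length (map val t) = \sum_(v <- t) fset_dist v (next t v).
Proof.
move=> ut; rewrite /tour_length big_map; apply: eq_bigr => v _.
by rewrite (next_map val_inj).
Qed.

Lemma tour_lift (R : realType) (d : nat) (X : {fset 'rV[R]_d}) (s : seq 'rV[R]_d) :
  perm_eq s X -> exists t : seq X, [/\ uniq t, forall v, v \in t & map val t = s].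
Proof.
move=> sX.
have [t tE] : exists t : seq X, map val t = s.
  have : {subset s <= X} by move=> x; rewrite (perm_mem sX).
  elim: s {sX} => [|x s IH] sub; first by exists [::].
  have [|t <-] := IH; first by move=> y ys; apply: sub; rewrite inE ys orbT.
  by exists ([` sub x (mem_head _ _)]%fset :: t).
exists t; split=> [|v|//].
  by rewrite -(map_inj_uniq val_inj) tE (perm_uniq sX) fset_uniq.
by rewrite -(mem_map val_inj) tE (perm_mem sX) (valP v).
Qed.

Lemma MST2_le_TSP (R : realType) (d : nat) (X : {fset 'rV[R]_d}) : MSTk 2 X <= TSP X.
Proof.
apply: lb_le_inf; first by exists (tour_length X), X => //=.
move=> _ [s /= /tour_lift[t [ut tX <-]] <-].
rewrite tour_length_map //.
apply: le_trans (cycle_graph_length (@fset_dist_ge0 _ _ X) (@fset_distC _ _ X) ut tX).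
apply: MSTk_le; first exact: cycle_graph_simple.
- exact: cycle_graph_connected.
- by move=> v; apply: cycle_graph_degree.
Qed.

Lemma TSP_le_MST2 (R : realType) (d : nat) (X : {fset 'rV[R]_d}) (D : R) :
  0 <= D -> (forall a b : X, fset_dist a b <= D) -> TSP X <= MSTk 2 X + D.
Proof.
move=> D0 XD; rewrite -lerBlDr; apply: MSTk_ge => // E [sE cE _] dE; rewrite lerBlDr.
have TSPle (t : seq X) : uniq t -> (forall v, v \in t) ->
    TSP X <= \sum_(v <- t) fset_dist v (next t v).
  move=> ut tX; rewrite -tour_length_map //; apply: ge_inf.
    by exists 0 => _ [s _ <-]; apply: sumr_ge0 => p _; apply: eucl_dist_ge0.
  exists (map val t) => //=; apply: uniq_perm; rewrite ?fset_uniq //.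
    by rewrite map_inj_uniq //; apply: val_inj.
  move=> x; apply/mapP/idP => [[v _ ->]|xX]; first exact: valP.
  by exists [` xX]%fset.
(* A Hamiltonian path needs a starting vertex; for empty [X] the empty tour has length 0. *)
have [x0 _|noX] := pickP (fun _ : X => true); last first.
  apply: (@le_trans _ _ 0); last by rewrite addr_ge0 // graph_length_ge0.
  apply: le_trans (TSPle [::] isT _) _; last by rewrite big_nil.
  by move=> v; have := noX v.
have [x [p [uxp pth xpX]]] := hamiltonian_path x0 sE cE dE.
apply: le_trans (TSPle _ uxp xpX) _.
apply: le_trans (path_tour_length (@fset_dist_ge0 _ _ X) (@fset_distC _ _ X) sE uxp pth) _.
by rewrite lerD2l.
Qed.

(** * Degrees in minimum spanning trees *)

(** For two edges va and vb, replacing av by ab cannot shorten the graph, so ab is at least as long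
    as av, and strictly longer without isosceles triangles. By symmetry ab is the longest side of
    the triangle, the angle at v exceeds 60 degrees, and the edge directions at v are separated. *)
Lemma minimal_tree_degree (R : realType) (d : nat) (V : finType)
    (p : V -> 'rV[R]_d) (E : {set V * V}) (v : V) :
  (2 <= d)%N -> injective p ->
  (forall a b c, a != b -> b != c -> c != a ->
    eucl_dist (p a) (p b) != eucl_dist (p a) (p c)) ->
  simple_graph E -> graph_connected E ->
  (forall F, simple_graph F -> graph_connected F ->
    wlen (fun a b => eucl_dist (p a) (p b)) E <= wlen (fun a b => eucl_dist (p a) (p b)) F) ->
  (degree E v <= strict_kissing_number R d)%N.
Proof.
move=> d2 pinj niso sE cE minE; set w := fun a b => _ in minE.
have w0 a b : 0 <= w a b by apply: eucl_dist_ge0.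
have wC a b : w a b = w b a by apply: eucl_distC.
have longer a b : a != b -> adj E v a -> adj E v b -> w a v < w a b.
  move=> ab va vb.
  have vna : v != a by apply: contraTneq va => ->; apply: sE.1.
  have vnb : v != b by apply: contraTneq vb => ->; apply: sE.1.
  have av : (a, v) \in E by apply: sE.2.
  rewrite lt_neqAle; apply/andP; split; first by apply: niso; rewrite // eq_sym.
  have sF := exchange_simple v sE ab.
  have cF : graph_connected (exchange E a v b).
    apply: exchange_connected => //; apply: connect1.
    rewrite /adj in_exchange !xpair_eqE (negbTE vna) (eq_sym b a) (negbTE ab) /= andbF.
    by rewrite [_ \in E]vb.
  have := minE _ sF cF; have := exchange_length b w0 wC sE av; lra.
have [_] := strict_kissing_numberP R d2; apply.
pose N := [pred a | adj E v a].
have Nv (i : 'I_(degree E v)) : adj E v (@enum_val _ N i) by have := @enum_valP _ N i.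
pose x (i : 'I_(degree E v)) := p (@enum_val _ N i) - p v.
have xpos i : 0 < dot (x i) (x i).
  rewrite lt0r dot_ge0 dot_eq0 subr_eq0 andbT; apply/eqP => /pinj e.
  by have := Nv i; rewrite e /adj (negbTE (sE.1 v)).
pose r i := Num.sqrt (dot (x i) (x i)).
have rpos i : 0 < r i by rewrite sqrtr_gt0.
have rE i : dot (x i) (x i) = r i ^+ 2 by rewrite sqr_sqrtr // ltW.
apply: (@separated_directions_kissing _ _ _ (fun i => (r i)^-1 *: x i)); split=> [i|i j ij].
  by rewrite dotZl dotZr rE; field; apply: lt0r_neq0.
have ij' : @enum_val _ N i != @enum_val _ N j by apply: contraNneq ij => /enum_val_inj->.
have half i' j' : @enum_val _ N i' != @enum_val _ N j' ->
    2 * dot (x i') (x j') < r j' ^+ 2.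
  move=> ne; have := longer _ _ ne (Nv i') (Nv j').
  rewrite -(ltr_pXn2r (ltn0Sn 1)) ?nnegrE // /w !sqr_eucl_dist.
  have -> : p (@enum_val _ N i') - p (@enum_val _ N j') = x i' - x j'.
    by rewrite /x opprB addrA subrK.
  rewrite (dot_sub (x i')) -/(x i') -(rE j'); lra.
have h1 := half _ _ ij'; have := half j i; rewrite eq_sym => /(_ ij') h2.
rewrite (dotC (x j)) in h2.
have ri := rpos i; have rj := rpos j.
rewrite dotZl dotZr mulrA -invfM mulrC ltr_pdivrMr ?mulr_gt0 //.
(* Twice the inner product is below the smaller of the two squared norms, which is at most their
   product [r i * r j]. *)
have [le|/ltW le] := lerP (r i) (r j); nra.
Qed.

(** A nonzero [q] has fewer than [size q] roots, so it cannot vanish at all the [size q] points e/2,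
    e/3, .... *)
Lemma poly_nonroot_near0 (R : realType) (q : {poly R}) (e : R) :
  q != 0 -> 0 < e -> exists2 t, 0 < t < e & q.[t] != 0.
Proof.
move=> q0 e0; apply: contrapT => H.
pose rs := [seq e / (i.+2)%:R | i <- iota 0 (size q)].
have : (size rs < size q)%N.
  apply: max_poly_roots => //.
    apply/allP => _ /mapP[i _ ->]; apply: contrapT => /negP nr; apply: H.
    exists (e / i.+2%:R) => //; rewrite divr_gt0 //= ltr_pdivrMr // ltr_pMr //.
    by rewrite ltr1n.
  rewrite map_inj_uniq ?iota_uniq // => i j /(mulfI (lt0r_neq0 e0)) /invr_inj /eqP.
  by rewrite eqr_nat => /eqP[].
by rewrite size_map size_iota ltnn.
Qed.

(** No power of 3 is the mean of two others: if one of them is larger, it is at least three times as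
    large; if both are smaller, their sum is too small. *)
Lemma expn3_asym (i j k : nat) : i != j -> i != k -> (3 ^ j + 3 ^ k != 2 * 3 ^ i)%N.
Proof.
move=> ij ik.
have mono a b : (a < b)%N -> (3 * 3 ^ a <= 3 ^ b)%N by move=> ab; rewrite -expnS leq_exp2l.
have p0 a : (0 < 3 ^ a)%N by rewrite expn_gt0.
have := p0 i; have := p0 j; have := p0 k.
case: (ltngtP i j) ij => // /mono h1 _; case: (ltngtP i k) ik => // /mono h2 _; lia.
Qed.

(* Moving the points along a line by multiples of distinct powers of 3, a small generic
   amount destroys every isosceles triangle: the difference of two squared side lengths is
   a quadratic polynomial in the amount, with nonzero leading coefficient. *)
Lemma generic_perturbation (R : realType) (d : nat) (V : finType)
    (p : V -> 'rV[R]_d) (e : R) : (2 <= d)%N -> 0 < e ->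
  exists p' : V -> 'rV[R]_d, [/\ injective p',
    forall a b c, a != b -> b != c -> c != a ->
      eucl_dist (p' a) (p' b) != eucl_dist (p' a) (p' c) &
    forall a, eucl_dist (p a) (p' a) <= e].
Proof.
move=> d2 e0; have [v vv _] := @orthogonal_unit R d 0 d2.
pose h (a : V) : R := (3 ^ enum_rank a)%:R.
pose q a b c : {poly R} :=
  (dot (p a - p b) (p a - p b) - dot (p a - p c) (p a - p c))%:P +
  (2 * ((h a - h b) * dot (p a - p b) v - (h a - h c) * dot (p a - p c) v)) *: 'X +
  ((h a - h b) ^+ 2 - (h a - h c) ^+ 2) *: 'X^2.
pose p' t a := p a + (t * h a) *: v.
have qE a b c t : (q a b c).[t] =
    dot (p' t a - p' t b) (p' t a - p' t b) - dot (p' t a - p' t c) (p' t a - p' t c).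
  rewrite !hornerD hornerC !hornerZ hornerX hornerXn.
  have sub x y : p' t x - p' t y = (p x - p y) + (t * (h x - h y)) *: v.
    by apply/rowP => j; rewrite !mxE; ring.
  rewrite !sub; move: (p a - p b) (p a - p c) => x y.
  rewrite !dotE vv !(dotC v); ring.
have q0 a b c : a != b -> b != c -> q a b c != 0.
  move=> ab bc; apply/eqP => /(congr1 (fun f : {poly R} => f`_2)).
  rewrite /q !coefD !coefZ coefC coefX coefXn /= !mulr0 mulr1 coef0 !add0r.
  (* The leading coefficient factors as (h c - h b) times (2 h a - h b - h c). The first factor is
     nonzero because the powers are distinct, the second by [expn3_asym], or directly when
     [a = c]. *)
  move/eqP; rewrite subr_sqr mulf_eq0 => /orP[].
    move=> /eqP e1; have /eqP : h b = h c by lra.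
    rewrite eqr_nat eqn_exp2l // => /eqP cb.
    by case/eqP: bc; apply: enum_rank_inj; apply: val_inj.
  move=> /eqP e1; have {e1} : h b + h c = 2%:R * h a by lra.
  rewrite /h -natrM -natrD => /eqP; rewrite eqr_nat => /eqP e1.
  have [ac|ac] := eqVneq a c.
    move: e1; rewrite ac.
    have : (3 ^ enum_rank b != 3 ^ enum_rank c :> nat)%N.
      rewrite eqn_exp2l //; apply: contraNneq bc => rbc; apply/eqP; apply: enum_rank_inj; exact: val_inj.
    by move=> /eqP; lia.
  have := @expn3_asym (enum_rank a) (enum_rank b) (enum_rank c).
  by rewrite !(inj_eq val_inj) !(inj_eq enum_rank_inj) => /(_ ab ac); lia.
pose Q := \prod_(a : V) \prod_(b : V | a != b) \prod_(c : V | b != c) q a b c.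
have Q0 : Q != 0.
  by apply/prodf_neq0 => a _; apply/prodf_neq0 => b ab; apply/prodf_neq0 => c bc; apply: q0.
pose M := \sum_a h a.
have h0 a : 0 <= h a by rewrite ler0n.
have hM a : h a <= M by rewrite /M (bigD1 a) //= lerDl sumr_ge0.
have M0 : 0 <= M by apply: sumr_ge0.
have [|t /andP[t0 te] Qt] := poly_nonroot_near0 Q0 (e := e / (M + 1)).
  by rewrite divr_gt0 //; lra.
have niso a b c : a != b -> b != c ->
    dot (p' t a - p' t b) (p' t a - p' t b) != dot (p' t a - p' t c) (p' t a - p' t c).
  move=> ab bc; rewrite -subr_eq0 -qE; apply: contraNneq Qt => qt.
  by rewrite /Q (bigD1 a) //= (bigD1 b) //= (bigD1 c) //= !hornerM qt !mul0r.
exists (p' t); split.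
(* In the degenerate case [c = a], [niso] says that the distance between distinct points is
   nonzero. *)
- move=> a b e1; apply: contrapT => /eqP ab.
  have := niso a b a ab; rewrite eq_sym => /(_ ab).
  by rewrite e1 eqxx.
- move=> a b c ab bc _; apply: contra (niso a b c ab bc) => /eqP e1.
  by rewrite -!sqr_eucl_dist e1.
- move=> a; rewrite eucl_distE.
  have -> : p a - p' t a = - ((t * h a) *: v) by rewrite opprD addrA subrr sub0r.
  rewrite dotNl dotNr opprK dotZl dotZr vv mulr1 -expr2 sqrtr_sqr.
  rewrite ger0_norm; last by rewrite mulr_ge0 // ltW.
  move: te; rewrite ltr_pdivlMr; last by lra.
  have := hM a; have := h0 a; nra.
Qed.

Lemma wlen_close (R : realType) (V : finType) (w w' : V -> V -> R) (E : {set V * V}) (e : R) :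
  0 <= e -> (forall a b, w a b <= w' a b + e) -> wlen w E <= wlen w' E + #|{: V * V}|%:R * e.
Proof.
move=> e0 ww'.
have : \sum_(p in E) w p.1 p.2 <= \sum_(p in E) w' p.1 p.2 + #|{: V * V}|%:R * e.
  apply: (@le_trans _ _ (\sum_(p in E) (w' p.1 p.2 + e))).
    by apply: ler_sum => p _; apply: ww'.
  rewrite big_split /= lerD2l sumr_const -[leLHS]mulr_natl ler_wpM2r // ler_nat.
  exact: max_card.
have : 0 <= #|{: V * V}|%:R * e by rewrite mulr_ge0.
rewrite /wlen; lra.
Qed.

Lemma MSTk_kissing (R : realType) (d : nat) (X : {fset 'rV[R]_d}) : (2 <= d)%N ->
  MSTk (strict_kissing_number R d) X = MST X.
Proof.
move=> d2; apply/eqP; rewrite eq_le; apply/andP; split; last first.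
  by apply: MSTk_ge (strict_kissing_number_ge2 R d2) _ => E tE _; apply: MST_le.
apply: MST_ge => E [sE cE _]; apply/ler_addgt0Pr => e e0.
pose N : R := #|{: X * X}|%:R.
have N0 : 0 <= N by [].
(* Each perturbed distance is off by at most [2 * e'], and lengths are compared twice over at most
   [N] pairs, so [4 * N * e'] must be at most [e]. The added 1 keeps the denominator positive. *)
have e'0 : 0 < e / (4 * (N + 1)) by rewrite divr_gt0 //; lra.
have [p' [p'inj niso close]] := @generic_perturbation R d X val _ d2 e'0.
set e' := e / _ in e'0 close.
pose w a b := eucl_dist (p' a) (p' b).
have ww' a b : w a b <= fset_dist a b + 2 * e'.
  have := eucl_dist_triangle (p' a) (val a) (p' b).
  have := eucl_dist_triangle (val a) (val b) (p' b).
  have := close a; have := close b; rewrite (eucl_distC (p' a) (val a)) /w /fset_dist; lra.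
have w'w a b : fset_dist a b <= w a b + 2 * e'.
  have := eucl_dist_triangle (val a) (p' a) (val b).
  have := eucl_dist_triangle (p' a) (p' b) (val b).
  have := close a; have := close b; rewrite (eucl_distC (p' b) (val b)) /w /fset_dist; lra.
have PE : `[< simple_graph E /\ graph_connected E >] by apply/asboolP.
pose P (F : {set X * X}) := `[< simple_graph F /\ graph_connected F >].
(* A shortest connected graph for the perturbed points, pruned to a tree, obeys the degree bound and
   is nearly optimal for the original points. *)
have [F /asboolP[sF cF] Fmin] : exists2 F, P F & forall F', P F' -> wlen w F <= wlen w F'.
  by case: (Order.TotalTheory.arg_minP (P := P) (wlen w) PE) => F; exists F.
have [F' F'F [sF' cF' aF']] := spanning_tree_exists sF cF.
have F'min G : simple_graph G -> graph_connected G -> wlen w F' <= wlen w G.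
  move=> sG cG; apply: (@le_trans _ _ (wlen w F)).
    by apply: wlen_sub => // a b; apply: eucl_dist_ge0.
  by apply: Fmin; apply/asboolP.
apply: (@le_trans _ _ (graph_length F')).
  by apply: MSTk_le => // v; apply: (minimal_tree_degree v d2 p'inj niso sF' cF' F'min).
have e2 : 0 <= 2 * e' by lra.
have h1 := wlen_close F' e2 w'w; have h2 := wlen_close E e2 ww'.
have h3 := F'min _ sE cE.
have h4 : N * (2 * e') + N * (2 * e') <= e.
  have : e' * (4 * (N + 1)) = e by rewrite /e' mulfVK // lt0r_neq0 //; lra.
  lra.
move: h1 h2; rewrite !graph_lengthE -/N; lra.
Qed.

(** * Uniform random points *)

(** An open ball of the sup norm, written by coordinates to match the product form of the uniform
    law. *)
Definition box (R : realType) (d : nat) (o : 'rV[R]_d) (r : R) : set 'rV[R]_d :=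
  [set v | forall j, `|v 0 j - o 0 j| < r]%classic.

Lemma borel_box (R : realType) (d : nat) (o : 'rV[R]_d) (r : R) :
  0 < r -> borel (box o r).
Proof.
move=> r0; apply: sub_sigma_algebra => /=.
have -> : box o r = ball o r.
  apply/seteqP; split=> v /=; last first.
    by move=> [_ bv] j; have := bv 0 j; rewrite /ball /= distrC.
  by move=> bv; split => // i j; rewrite (ord1 i) /ball /= distrC.
exact: ball_open.
Qed.

Lemma borelC (R : realType) (d : nat) (A : set 'rV[R]_d) :
  borel A -> borel (~` A)%classic.
Proof. by move=> bA; rewrite -setTD; apply: sigma_algebraCD. Qed.

Lemma uniform_prob_itv (R : realType) (a b : R) :
  0 <= a -> a <= b -> b <= 1 ->
  uniform_prob (@ltr01 R) `]a, b[%classic = (b - a)%:E.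
Proof.
move=> a0 ab b1; rewrite /uniform_prob integral_uniform_pdf setIidl; last first.
  by move=> x /=; rewrite !in_itv /= => /andP[ax xb]; apply/andP; split; lra.
rewrite (eq_integral (fun=> 1%E)); last first.
  move=> x; rewrite inE /= in_itv /= => /andP[ax xb].
  rewrite /uniform_pdf ifT; last by apply/andP; split; lra.
  by rewrite subr0 invr1.
rewrite integral_cst //= mul1e lebesgue_measure_itv /= lte_fin.
case: (ltP a b) => [_|ba]; first exact: erefl.
by have -> : b = a; [apply/le_anti; rewrite ab ba | rewrite subrr].
Qed.

Section RandomPoints.
Context (R : realType) (d : nat) (dT : measure_display) (T : measurableType dT).
Context (P : probability T R) (x : nat -> T -> 'rV[R]_d).
Hypothesis hx : iid_uniform P x.

Lemma prob_box (i : nat) (o : 'rV[R]_d) (r : R) :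
  0 < r -> (forall j, r <= o 0 j <= 1 - r) ->
  P (x i @^-1` box o r)%classic = ((2 * r) ^+ d)%:E.
Proof.
move=> r0 oin; case: hx => _ _ /(_ i (fun j => `](o 0 j - r), (o 0 j + r)[%classic)).
rewrite (_ : [set w | _]%classic = x i @^-1` box o r)%classic; last first.
  apply/seteqP; split=> w /= H j; have := H j; rewrite in_itv /= ltr_distl //.
move=> ->; last by move=> j; apply: measurable_itv.
rewrite (eq_bigr (fun=> (2 * r)%:E)).
  by rewrite prodEFin prodr_const card_ord.
move=> j _; rewrite uniform_prob_itv.
- by congr EFin; ring.
- by have /andP[] := oin j; lra.
- by lra.
- by have /andP[] := oin j; lra.
Qed.

Lemma measurable_point (i : nat) (A : set 'rV[R]_d) :
  borel A -> measurable (x i @^-1` A)%classic.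
Proof. by case: hx => mx _ _; apply: mx. Qed.

Lemma ae_in_cube : {ae P, forall w, forall i j, 0 <= x i w 0 j <= 1}.
Proof.
apply: ae_foralln => i; pose o : 'rV[R]_d := const_mx (1 / 2).
have h0 : 0 < 1 / 2 :> R by lra.
have mB := measurable_point i (borel_box o h0).
apply: (@negligibleS _ _ _ _ (~` (x i @^-1` box o (1 / 2)))%classic).
  move=> w /= nw xB; apply: nw => j; have := xB j.
  by rewrite mxE ltr_distl => /andP[]; lra.
apply/negligibleP; first exact: measurableC.
apply: (eq_trans (probability_setC P mB)).
rewrite prob_box // => [|j]; last by rewrite mxE; lra.
have -> : 2 * (1 / 2) = 1 :> R by lra.
by rewrite expr1n subee.
Qed.

(** * Probability of an isolated pattern of points *)

Section Gadget.
Context (n K : nat) (Q : set 'rV[R]_d) (b : 'I_K -> set 'rV[R]_d).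

(** The event that the points selected by [t] fill the boxes and all others avoid [Q] is expressed
    as one condition on each point, so that independence gives its probability as a product. *)
Definition gadget_target (t : 'I_K -> 'I_n) (l : nat) : set 'rV[R]_d :=
  (if [pick i | val (t i) == l] is Some i then b i else ~` Q)%classic.

Definition gadget_event (t : 'I_K -> 'I_n) : set T :=
  (\bigcap_(l in [set` index_iota 0 n]) (x l @^-1` gadget_target t l))%classic.

Hypotheses (bQ : borel Q) (bb : forall i, borel (b i)).

Lemma borel_gadget_target t l : borel (gadget_target t l).
Proof. by rewrite /gadget_target; case: pickP => // _; apply: borelC. Qed.

Lemma measurable_gadget_event t : measurable (gadget_event t).
Proof.
apply: fin_bigcap_measurable => [|l _]; first exact: finite_seq.
apply: measurable_point; exact: borel_gadget_target.
Qed.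

Lemma gadget_eventP (t : 'I_K -> 'I_n) (w : T) : injective t -> gadget_event t w ->
  (forall i, b i (x (t i) w)) /\
  (forall l : 'I_n, Q (x l w) -> exists i, l = t i).
Proof.
move=> tinj H; split=> [i|l Ql].
  have := H (t i); rewrite /= mem_index_iota ltn_ord => /(_ isT).
  rewrite /gadget_target; case: pickP => [j /eqP /val_inj /tinj -> //|/(_ i)].
  by rewrite eqxx.
have := H l; rewrite /= mem_index_iota ltn_ord => /(_ isT).
rewrite /gadget_target; case: pickP => [j /eqP /val_inj <- _|//]; by exists j.
Qed.

Lemma prob_gadget_event (t : 'I_K -> 'I_n) (q r : R) :
  injective t -> (forall l, P (x l @^-1` Q)%classic = q%:E) ->
  (forall l i, P (x l @^-1` b i)%classic = r%:E) ->
  P (gadget_event t) = (r ^+ K * (1 - q) ^+ (n - K))%:E.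
Proof.
move=> tinj Pq Pr; case: (hx) => _ ind _.
rewrite /gadget_event ind ?iota_uniq //; last exact: borel_gadget_target.
rewrite big_mkord.
pose A := [set t i | i in [set: 'I_K]]%SET.
rewrite (eq_bigr (fun l => (if l \in A then r else 1 - q)%:E)); last first.
  move=> l _; rewrite /gadget_target; case: pickP => [i /eqP/val_inj til|nt].
    by rewrite Pr -til imset_f // inE.
  rewrite ifF; last by apply/negP => /imsetP[i _ li]; have := nt i; rewrite li eqxx.
  by rewrite preimage_setC probability_setC ?Pq //; apply: measurable_point.
have cA : #|A| = K by rewrite card_imset // cardsT card_ord.
rewrite prodEFin (bigID (mem A)) /=; congr (_ * _)%:E.
  by rewrite (eq_bigr (fun=> r)) => [|l /= ->//]; rewrite prodr_const cA.
rewrite (eq_bigr (fun=> 1 - q)) => [|l /= /negbTE ->//]; rewrite prodr_const.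
have := cardC A; rewrite cA card_ord => e.
congr (_ ^+ _); rewrite -[X in (X - K)%N]e addKn.
by apply: eq_card => l; rewrite !inE.
Qed.
End Gadget.
End RandomPoints.

(** * Geometry of gadgets *)

Lemma eucl_dist_affine (R : realType) (d : nat) (o a b : 'rV[R]_d) (s : R) :
  0 <= s -> eucl_dist (o + s *: a) (o + s *: b) = s * eucl_dist a b.
Proof.
move=> s0; rewrite !eucl_distE.
have -> : o + s *: a - (o + s *: b) = s *: (a - b).
  by rewrite scalerBr opprD addrACA subrr add0r.
by rewrite dotZl dotZr mulrA sqrtrM ?mulr_ge0 // -expr2 sqrtr_sqr ger0_norm.
Qed.

Lemma point_setP (R : realType) (d : nat) (T : Type) (x : nat -> T -> 'rV[R]_d)
    (n : nat) (w : T) (z : 'rV[R]_d) :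
  reflect (exists l : 'I_n, z = x l w) (z \in point_set x n w).
Proof.
apply: (iffP (imfsetP _ _ _ _)) => [[l _ ->]|[l ->]]; first by exists l.
by exists l; rewrite ?inE.
Qed.

(** All points near [c] count as its leaves, so the set of leaves depends on [c] alone and not on an
    assignment [t]. *)
Definition neighborhood (R : realType) (d : nat) (X : {fset 'rV[R]_d}) (r : R) (c : X) :
    {set X} :=
  [set z | (z != c) && (fset_dist c z < r)]%SET.

Definition is_gadget (R : realType) (d n K : nat) (f : nat -> 'rV[R]_d)
    (Q : set 'rV[R]_d) (b : 'I_K -> set 'rV[R]_d) (t : 'I_K -> 'I_n) : Prop :=
  [/\ injective t, forall i, b i (f (t i)) & forall l : 'I_n, Q (f l) -> exists i, l = t i].

Section GadgetGeometry.
Context (R : realType) (d k : nat) (v : 'I_k.+2 -> 'rV[R]_d) (g h : R).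
Hypotheses (d_gt0 : (0 < d)%N) (g_gt0 : 0 < g) (g_le1 : g <= 1) (h_gt0 : 0 < h).
Hypotheses (v0 : v ord0 = 0) (v1 : forall i, i != ord0 -> eucl_dist (v i) 0 = 1).
Hypothesis v2 : forall i j, i != ord0 -> j != ord0 -> i != j -> 1 + g <= eucl_dist (v i) (v j).

(** The denominator puts every point of a box within [g * h / 8] of its ideal position, so that
    distances between two boxes are off by at most [g * h / 4]. *)
Definition gadget_radius : R := g * h / (8 * d%:R).
Definition gadget_box (o : 'rV[R]_d) (i : 'I_k.+2) := box (o + h *: v i) gadget_radius.
Definition gadget_cell (o : 'rV[R]_d) := box o (8 * h).

Lemma gadget_radius_gt0 : 0 < gadget_radius.
Proof. by rewrite divr_gt0 ?mulr_gt0 ?ltr0n. Qed.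

Lemma gadget_box_near o i p : gadget_box o i p -> eucl_dist p (o + h *: v i) <= g * h / 8.
Proof.
move=> bp; have := @eucl_dist_le_coord _ _ p _ gadget_radius (fun j => ltW (bp j)).
have d0 : d%:R != 0 :> R by rewrite pnatr_eq0 -lt0n.
rewrite /gadget_radius (_ : d%:R * _ = g * h / 8) //; field.
exact: d0.
Qed.

Lemma gadget_box_dist o i j p q : gadget_box o i p -> gadget_box o j q ->
  h * eucl_dist (v i) (v j) - g * h / 4 <= eucl_dist p q <=
  h * eucl_dist (v i) (v j) + g * h / 4.
Proof.
move=> /gadget_box_near bp /gadget_box_near bq.
rewrite -(eucl_dist_affine o _ _ (ltW h_gt0)); move: bp bq.
set a := o + h *: v i; set b := o + h *: v j => bp bq.
have := eucl_dist_triangle p a q; have := eucl_dist_triangle a b q.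
have := eucl_dist_triangle a p b; have := eucl_dist_triangle p q b.
rewrite (eucl_distC b q) (eucl_distC a p) => *; apply/andP; split; lra.
Qed.

Lemma gadget_vec_le1 i : eucl_dist (v i) 0 <= 1.
Proof.
have [->|/v1 ->//] := eqVneq i ord0; rewrite v0 eucl_distE subrr.
by rewrite -(scale0r 0) dotZl mul0r sqrtr0.
Qed.

Lemma gadget_box_center o i p : gadget_box o i p -> eucl_dist p o <= h + g * h / 8.
Proof.
move=> /gadget_box_near bp; have := eucl_dist_triangle p (o + h *: v i) o.
have -> : eucl_dist (o + h *: v i) o = h * eucl_dist (v i) 0.
  by rewrite -(eucl_dist_affine o _ _ (ltW h_gt0)) scaler0 addr0.
have : h * eucl_dist (v i) 0 <= h by rewrite ler_piMr ?gadget_vec_le1 // ltW.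
lra.
Qed.

Lemma gadget_cell_near o z : eucl_dist z o < 8 * h -> gadget_cell o z.
Proof. by move=> zo j; apply: le_lt_trans (coord_le_eucl_dist z o j) zo. Qed.

Lemma gadget_cell_far o z : ~ gadget_cell o z -> 8 * h <= eucl_dist z o.
Proof. by move=> nz; rewrite leNgt; apply/negP => /gadget_cell_near. Qed.

Lemma gh_le : 0 < g * h <= h.
Proof. by rewrite mulr_gt0 //= ler_piMl // ltW. Qed.

Lemma gadget_box_cell o i p : gadget_box o i p -> gadget_cell o p.
Proof.
move=> /gadget_box_center bp; apply: gadget_cell_near; apply: le_lt_trans bp _.
have /andP[] := gh_le; have := h_gt0; lra.
Qed.

Lemma gadget_vec_sep i j : i != j -> 1 <= eucl_dist (v i) (v j).
Proof.
move=> ij; have [i0|i0] := eqVneq i ord0.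
  by rewrite i0 v0 eucl_distC v1 // -i0 eq_sym.
have [j0|j0] := eqVneq j ord0; first by rewrite j0 v0 v1.
have := v2 i0 j0 ij; have := g_gt0; lra.
Qed.

Lemma gadget_box_inj o i j p : gadget_box o i p -> gadget_box o j p -> i = j.
Proof.
move=> bi bj; apply: contrapT => /eqP /gadget_vec_sep sep.
have /andP[+ _] := gadget_box_dist bi bj.
have -> : eucl_dist p p = 0 by rewrite eucl_distE subrr -(scale0r 0) dotZl mul0r sqrtr0.
have /andP[] := gh_le; have := h_gt0; nra.
Qed.

(** The radius [4 * h] is large enough to reach all [k.+1] leaves, at distance about [h], and small
    enough to stay inside the cell, where the gadget has the only points. *)
Lemma gadget_center (n : nat) (X : {fset 'rV[R]_d}) (f : nat -> 'rV[R]_d) (o : 'rV[R]_d)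
    (t : 'I_k.+2 -> 'I_n) (c : X) :
  (forall z, reflect (exists l : 'I_n, z = f l) (z \in X)) ->
  is_gadget f (gadget_cell o) (gadget_box o) t -> val c = f (t ord0) ->
  (k < #|neighborhood (4 * h) c|)%N /\
  forall u z, u \in neighborhood (4 * h) c -> z != c -> z != u ->
    fset_dist u c + g * h / 2 <= fset_dist u z.
Proof.
move=> XP [tinj tb tQ] cE.
have /andP[gh0 gh1] := gh_le; have h0 := h_gt0.
have cb : gadget_box o ord0 (val c) by rewrite cE.
have co := gadget_box_center cb.
have inQ (z : X) : gadget_cell o (val z) -> z != c ->
    exists2 i, i != ord0 & val z = f (t i).
  move=> zQ zc; have /XP[l zl] := valP z.
  have [|i li] := tQ l; first by rewrite -zl.
  exists i; last by rewrite zl li.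
  by apply: contraNneq zc => i0; apply/eqP/val_inj; rewrite zl li i0 cE.
have leaf (u : X) : u \in neighborhood (4 * h) c ->
    exists2 i, i != ord0 & val u = f (t i).
  rewrite inE => /andP[uc cu]; apply: inQ => //; apply: gadget_cell_near.
  have := eucl_dist_triangle (val u) (val c) o.
  rewrite (eucl_distC (val u) (val c)); rewrite /fset_dist in cu; lra.
split; last first.
  move=> u z /leaf[i i0 ui] zc zu.
  have ub : gadget_box o i (val u) by rewrite ui.
  have /andP[_ uc] := gadget_box_dist ub cb.
  rewrite v0 v1 // mulr1 in uc.
  (* A leaf is within [h + g * h / 4] of the center. Other leaves are at least
     [(1 + g) * h - g * h / 4] away from it, and points outside the cell are farther still; this
     leaves the gain [g * h / 2]. *)
  rewrite /fset_dist; apply: (@le_trans _ _ (h + 3 * (g * h) / 4)); first lra.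
  have [zQ|/gadget_cell_far zQ] := pselect (gadget_cell o (val z)).
    have [j j0 zj] := inQ z zQ zc.
    have zb : gadget_box o j (val z) by rewrite zj.
    have ij : i != j by apply: contraNneq zu => ij; apply/eqP/val_inj; rewrite zj ui ij.
    have /andP[uz _] := gadget_box_dist ub zb; apply: le_trans uz.
    by have := v2 i0 j0 ij; rewrite -(ler_pM2l h_gt0); lra.
  have := gadget_box_center ub.
  have := eucl_dist_triangle (val z) (val u) o; rewrite (eucl_distC (val z) (val u)); lra.
pose l (i : 'I_k.+1) : X := [` introT (XP _) (ex_intro _ (t (lift ord0 i)) erefl)]%fset.
have linj : injective l.
  move=> i j /(congr1 val) /= e.
  have bi := tb (lift ord0 i); have bj := tb (lift ord0 j); rewrite e in bi.
  by have := gadget_box_inj bi bj => /lift_inj.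
rewrite -[k.+1](card_ord k.+1) -cardsT -(card_imset _ linj); apply: subset_leq_card.
apply/fintype.subsetP => _ /imsetP[i _ ->]; rewrite inE; apply/andP; split.
  apply/eqP => /(congr1 val) /= e; have bi := tb (lift ord0 i); rewrite e in bi.
  by have /eqP := gadget_box_inj bi cb.
rewrite /fset_dist /=; have /andP[_] := gadget_box_dist cb (tb (lift ord0 i)).
by rewrite eucl_distC v0 (eucl_distC 0) v1 //; rewrite eucl_distC; lra.
Qed.

(** Different cells are disjoint, so a common center forces the same cell. Every point of one gadget
    is then a point of the other, and the disjointness of the boxes matches the indices. *)
Lemma gadgets_distinct (n : nat) (f : nat -> 'rV[R]_d) (J : finType) (o : J -> 'rV[R]_d)
    (j j' : J) (t t' : 'I_k.+2 -> 'I_n) :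
  (forall i i', i != i' -> exists l, 16 * h <= `|o i 0 l - o i' 0 l|) ->
  is_gadget f (gadget_cell (o j)) (gadget_box (o j)) t ->
  is_gadget f (gadget_cell (o j')) (gadget_box (o j')) t' ->
  f (t ord0) = f (t' ord0) -> j = j' /\ t =1 t'.
Proof.
move=> sep [tinj tb tQ] [tinj' tb' tQ'] e.
have jj' : j = j'.
  apply: contrapT => /eqP /sep[l].
  have := gadget_box_cell (tb ord0) l; have := gadget_box_cell (tb' ord0) l; rewrite -e.
  move: (f _ 0 l) (o j 0 l) (o j' 0 l) => a p q aq ap.
  have := ler_distD a p q; rewrite (distrC p a); lra.
split=> // i; rewrite -jj' in tb' tQ'.
have [i' ii'] := tQ' _ (gadget_box_cell (tb i)).
have bi := tb i; rewrite ii' in bi.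
by rewrite ii' (gadget_box_inj bi (tb' i')).
Qed.

Lemma MSTk_gadgets (n : nat) (X : {fset 'rV[R]_d}) (f : nat -> 'rV[R]_d)
    (J : finType) (o : J -> 'rV[R]_d) (S : {set J * {ffun 'I_k.+2 -> 'I_n}}) :
  (2 <= k)%N ->
  (forall z, reflect (exists l : 'I_n, z = f l) (z \in X)) ->
  (forall i i', i != i' -> exists l, 16 * h <= `|o i 0 l - o i' 0 l|) ->
  (forall p, p \in S -> is_gadget f (gadget_cell (o p.1)) (gadget_box (o p.1)) p.2) ->
  MSTk k.+1 X + #|S|%:R * (g * h / 2) <= MSTk k X.
Proof.
move=> k2 XP sep SP.
pose c (p : J * {ffun 'I_k.+2 -> 'I_n}) : X :=
  [` introT (XP _) (ex_intro _ (p.2 ord0) erefl)]%fset.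
have cinj : {in S &, injective c}.
  move=> [j t] [j' t'] /SP tS /SP tS' /(congr1 val) /= e.
  have [/= -> tt'] := gadgets_distinct sep tS tS' e.
  by congr (_, _); apply/ffunP.
pose C := [seq c p | p <- enum S].
have -> : #|S| = size C by rewrite size_map -cardE.
apply: (MSTk_centers (U := fun c => neighborhood (4 * h) c)) => //.
- by rewrite map_inj_in_uniq ?enum_uniq // => p q; rewrite !mem_enum; apply: cinj.
- move=> _ /mapP[p + ->]; rewrite mem_enum => /SP pS; rewrite inE eqxx; split=> //.
  by have [] := gadget_center XP pS (erefl : val (c p) = _).
- move=> _ u z /mapP[p + ->]; rewrite mem_enum => /SP pS.
  by have [_] := gadget_center XP pS (erefl : val (c p) = _); apply.
Qed.

Lemma card_gadgets (n : nat) (f : nat -> 'rV[R]_d)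
    (J : finType) (o : J -> 'rV[R]_d) (S : {set J * {ffun 'I_k.+2 -> 'I_n}}) :
  (forall i i', i != i' -> exists l, 16 * h <= `|o i 0 l - o i' 0 l|) ->
  (forall p, p \in S -> is_gadget f (gadget_cell (o p.1)) (gadget_box (o p.1)) p.2) ->
  (#|S| <= n)%N.
Proof.
move=> sep SP; rewrite -[X in (_ <= X)%N](card_ord n).
pose c (p : J * {ffun 'I_k.+2 -> 'I_n}) := p.2 ord0.
have cinj : {in S &, injective c}.
  move=> [j t] [j' t'] /SP tS /SP tS' e.
  have [/= -> tt'] := gadgets_distinct sep tS tS' (congr1 (fun l : 'I_n => f l) e).
  by congr (_, _); apply/ffunP.
by rewrite -(card_in_imset cinj) max_card.
Qed.
End GadgetGeometry.

(** * Expected number of gadgets *)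

Lemma gadget_vectors (R : realType) (d k : nat) :
  (2 <= d)%N -> (1 <= k)%N -> (k < strict_kissing_number R d)%N ->
  exists (v : 'I_k.+2 -> 'rV[R]_d) (g : R),
    [/\ 0 < g <= 1, v ord0 = 0, forall i, i != ord0 -> eucl_dist (v i) 0 = 1 &
        forall i j, i != ord0 -> j != ord0 -> i != j -> 1 + g <= eucl_dist (v i) (v j)].
Proof.
move=> d2 k1 kt; have [ct _] := strict_kissing_numberP R d2.
have [u au] := kissing_separated_directions d2 (k1 : (1 < k.+1)%N) (kissing_mono kt ct).
have [m m0 um] := separated_directions_gap au; case: au => u1 _.
pose v (i : 'I_k.+2) := if unlift ord0 i is Some j then u j else 0.
(* Squared distances of the directions are at least [1 + 2 * m], and [(1 + g) ^+ 2 <= 1 + 3 * g] is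
   below that. *)
pose g := Num.min 1 (m / 2).
have g0 : 0 < g by rewrite lt_min ltr01 divr_gt0.
have g1 : g <= 1 by rewrite ge_min lexx.
have gm : g <= m / 2 by rewrite ge_min lexx orbT.
have vE (i : 'I_k.+2) : i != ord0 -> exists2 j, i = lift ord0 j & v i = u j.
  by rewrite /v; case: unliftP => [j ->|->]; [exists j|rewrite eqxx].
exists v, g; split; first by rewrite g0.
- by rewrite /v unlift_none.
- by move=> i /vE[j _ ->]; apply/eucl_dist_eq; rewrite ?subr0 ?u1 ?expr1n.
- move=> i j /vE[i' -> ->] /vE[j' -> ->]; rewrite (inj_eq lift_inj) => ij.
  rewrite -(ler_pXn2r (ltn0Sn 1)) ?nnegrE ?eucl_dist_ge0 //; last by lra.
  rewrite sqr_eucl_dist dot_sub !u1; have := um _ _ ij; nra.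
Qed.

Lemma ffact_lower (n m K : nat) : (m <= K)%N -> ((n - K) ^ m <= n ^_ m)%N.
Proof.
elim: m => [|m IH] mK; first by rewrite ffactn0.
rewrite expnSr ffactnSr; apply: leq_mul; first by apply: IH; apply: ltnW.
by apply: leq_sub2l; apply: ltnW.
Qed.

Lemma bernoulli_sub (R : realType) (q : R) (N : nat) :
  0 <= q <= 1 -> 1 - N%:R * q <= (1 - q) ^+ N.
Proof.
move=> /andP[q0 q1]; elim: N => [|N IH]; first by rewrite mul0r subr0 expr0.
have h : 0 <= (1 - q) ^+ N <= 1 by rewrite exprn_ge0 ?exprn_ile1 //; lra.
have /andP[h0 h1] := h.
rewrite exprSr -natr1; have : 0 <= N%:R :> R by [].
nra.
Qed.

(** The centres of the [m ^ d] cubes of side 1/m that tile the unit cube. *)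
Definition grid_point (R : realType) (d m : nat) (j : {ffun 'I_d -> 'I_m}) : 'rV[R]_d :=
  \row_l (((j l)%:R + 1 / 2) / m%:R).

Lemma grid_point_sep (R : realType) (d m : nat) (i j : {ffun 'I_d -> 'I_m}) : (0 < m)%N ->
  i != j -> exists l, m%:R^-1 <= `|grid_point R i 0 l - grid_point R j 0 l|.
Proof.
move=> m0 ij; have [l ijl] : exists l, i l != j l.
  apply/existsP; apply: contraNT ij; rewrite negb_exists => /forallP H.
  by apply/eqP/ffunP => l; apply/eqP; have := H l; rewrite negbK.
exists l; rewrite !mxE.
have -> : ((i l)%:R + 1 / 2) / m%:R - ((j l)%:R + 1 / 2) / m%:R =
  ((i l)%:R - (j l)%:R) / m%:R :> R by ring.
rewrite normrM normfV (ger0_norm (ler0n R m)) ler_peMl ?invr_ge0 //.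
have : (i l < j l)%N || (j l < i l)%N by rewrite -neq_ltn.
have nat1 (a b : nat) : (a < b)%N -> 1 <= b%:R - a%:R :> R.
  by move=> ab; rewrite -natrB 1?ltnW // ler1n subn_gt0.
by move=> /orP[] /nat1 h; [rewrite distrC|]; apply: le_trans h (ler_norm _).
Qed.

Section GadgetCount.
Context (R : realType) (d : nat) (dT : measure_display) (T : measurableType dT).
Context (P : probability T R) (x : nat -> T -> 'rV[R]_d).
Hypotheses (hx : iid_uniform P x) (d_ge2 : (2 <= d)%N).
Context (k : nat) (v : 'I_k.+2 -> 'rV[R]_d) (g : R).
Hypotheses (g_itv : 0 < g <= 1) (v0 : v ord0 = 0).
Hypothesis v1 : forall i, i != ord0 -> eucl_dist (v i) 0 = 1.
Hypothesis v2 : forall i j, i != ord0 -> j != ord0 -> i != j -> 1 + g <= eucl_dist (v i) (v j).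

(** With this scale a gadget cell has side 1/(2m), half that of a grid cube, so cells of distinct
    cubes are disjoint and lie inside the unit cube. *)
Definition grid_scale (m : nat) : R := (32 * m%:R)^-1.

Local Notation gadget_index m :=
  ({ffun 'I_d -> 'I_m} * {ffun 'I_k.+2 -> 'I_(m ^ d)})%type.

Definition grid_gadget_event (m : nat)
    (p : gadget_index m) : set T :=
  gadget_event x (gadget_cell (grid_scale m) (grid_point R p.1))
    (gadget_box v g (grid_scale m) (grid_point R p.1)) p.2.

(** A sum of indicators over cubes and injective assignments, so that its expectation is a sum of
    probabilities; the number of points [m ^ d] equals the number of cubes. *)
Definition gadget_count (m : nat) (w : T) : R :=
  \sum_(p : gadget_index m | injectiveb p.2)
    \1_(grid_gadget_event p) w.

Let g_gt0 : 0 < g. Proof. by case/andP: g_itv. Qed.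
Let g_le1 : g <= 1. Proof. by case/andP: g_itv. Qed.
Let d_gt0 : (0 < d)%N. Proof. exact: ltnW. Qed.
Let dR_gt0 : 0 < d%:R :> R. Proof. by rewrite ltr0n. Qed.
Lemma grid_scale_gt0 m : (0 < m)%N -> 0 < grid_scale m.
Proof. by move=> m0; rewrite invr_gt0 mulr_gt0 ?ltr0n. Qed.
Lemma grid_scaleE m : (0 < m)%N -> m%:R * grid_scale m = 1 / 32.
Proof. by move=> m0; rewrite /grid_scale; field; rewrite pnatr_eq0 -lt0n. Qed.

Lemma measurable_grid_gadget_event m p :
  (0 < m)%N -> measurable (@grid_gadget_event m p).
Proof.
move=> m0; apply: (measurable_gadget_event hx) => [|i]; apply: borel_box.
  by have := grid_scale_gt0 m0; lra.
by apply: gadget_radius_gt0 => //; apply: grid_scale_gt0.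
Qed.

Lemma gadget_countE m w : gadget_count m w =
  #|[set p : gadget_index m |
      injectiveb p.2 && `[< grid_gadget_event p w >]]%SET|%:R.
Proof.
rewrite /gadget_count -sum1_card natr_sum big_mkcond [RHS]big_mkcond; apply: eq_bigr => p _.
rewrite inE /=; case: injectiveb => //=.
case: asboolP => [ew|ew]; rewrite indicE; first by rewrite mem_set.
by rewrite memNset.
Qed.

Lemma grid_gadgets m w : (0 < m)%N ->
  forall p, p \in [set p : gadget_index m |
      injectiveb p.2 && `[< grid_gadget_event p w >]]%SET ->
  is_gadget (fun l => x l w) (gadget_cell (grid_scale m) (grid_point R p.1))
    (gadget_box v g (grid_scale m) (grid_point R p.1)) p.2.
Proof.
move=> m0 p; rewrite inE => /andP[/injectiveP tinj /asboolP ew].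
by have [tb tQ] := gadget_eventP tinj ew; split.
Qed.

Lemma grid_sep m : (0 < m)%N -> forall i j : {ffun 'I_d -> 'I_m}, i != j ->
  exists l, 16 * grid_scale m <= `|grid_point R i 0 l - grid_point R j 0 l|.
Proof.
move=> m0 i j /(grid_point_sep R m0)[l ijl]; exists l; apply: le_trans ijl.
rewrite -(ler_pM2l (_ : 0 < m%:R)) ?ltr0n // mulfV ?pnatr_eq0 -?lt0n //.
rewrite mulrCA grid_scaleE //; lra.
Qed.

Lemma gadget_count_le m w : (0 < m)%N -> gadget_count m w <= (m ^ d)%:R.
Proof.
move=> m0; rewrite gadget_countE ler_nat.
apply: (card_gadgets d_gt0 g_gt0 g_le1 (grid_scale_gt0 m0) v0 v1 v2 (grid_sep m0)).
exact: grid_gadgets.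
Qed.

Lemma MSTk_gadget_count m w : (2 <= k)%N -> (0 < m)%N ->
  MSTk k.+1 (point_set x (m ^ d) w) + gadget_count m w * (g * grid_scale m / 2) <=
  MSTk k (point_set x (m ^ d) w).
Proof.
move=> k2 m0; rewrite gadget_countE.
apply: (MSTk_gadgets d_gt0 g_gt0 g_le1 (grid_scale_gt0 m0) v0 v1 v2 k2 _ (grid_sep m0)); last exact: grid_gadgets.
by move=> z; apply: point_setP.
Qed.

Lemma prob_grid_gadget_event m
    (p : gadget_index m) :
  (0 < m)%N -> injective p.2 ->
  P (grid_gadget_event p) =
  ((((g / (128 * d%:R)) / m%:R) ^+ d) ^+ k.+2 *
    (1 - (2 * m%:R)^-1 ^+ d) ^+ (m ^ d - k.+2))%:E.
Proof.
move=> m0 tinj; have mR : 0 < m%:R :> R by rewrite ltr0n.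
have hm := grid_scale_gt0 m0; have hmE := grid_scaleE m0.
have dn0 := lt0r_neq0 dR_gt0; have mn0 := lt0r_neq0 mR.
(* Grid points are at least 1/(2m) = 16 [grid_scale m] away from the boundary of the cube, so the
   cells and boxes lie inside it and their probabilities are their volumes. *)
have cellP (p' : {ffun 'I_d -> 'I_m}) (j : 'I_d) :
    16 * grid_scale m <= grid_point R p' 0 j <= 1 - 16 * grid_scale m.
  have jm : (p' j)%:R + 1 <= m%:R :> R by rewrite natr1 ler_nat.
  have j0 : 0 <= (p' j)%:R :> R by [].
  rewrite mxE ler_pdivlMr // ler_pdivrMr // mulrBl -!mulrA (mulrC (grid_scale m)) hmE; apply/andP; split; lra.
have bQ : borel (gadget_cell (grid_scale m) (grid_point R p.1)) by apply: borel_box; lra.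
have rho0 := gadget_radius_gt0 d_gt0 g_gt0 hm.
have bb i : borel (gadget_box v g (grid_scale m) (grid_point R p.1) i) by apply: borel_box.
have Pq l : P (x l @^-1` gadget_cell (grid_scale m) (grid_point R p.1))%classic =
    ((2 * (8 * grid_scale m)) ^+ d)%:E.
  apply: (prob_box hx); first by lra.
  by move=> j; have /andP[] := cellP p.1 j; move=> *; apply/andP; split; lra.
have Pr l i : P (x l @^-1` gadget_box v g (grid_scale m) (grid_point R p.1) i)%classic =
    ((2 * gadget_radius d g (grid_scale m)) ^+ d)%:E.
  apply: (prob_box hx); first exact: rho0.
  move=> j; rewrite !mxE; have /andP[c1 c2] := cellP p.1 j; rewrite mxE in c1 c2.
  have gh : gadget_radius d g (grid_scale m) <= grid_scale m.
    rewrite ler_pdivrMr ?mulr_gt0 //.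
    have : grid_scale m * 1 <= grid_scale m * d%:R by rewrite ler_pM2l // ler1n.
    have : g * grid_scale m <= grid_scale m by rewrite ler_piMl // ltW.
    lra.
  have := le_trans (coord_le_eucl_dist (v i) 0 j) (gadget_vec_le1 v0 v1 i).
  rewrite mxE subr0 ler_norml => /andP[lo hi].
  have lo' : - grid_scale m <= grid_scale m * v i 0 j by nra.
  have hi' : grid_scale m * v i 0 j <= grid_scale m by nra.
  by apply/andP; split; lra.
rewrite (prob_gadget_event hx bQ bb tinj Pq Pr); congr (_ ^+ _ * _)%:E.
  by congr (_ ^+ _); rewrite /gadget_radius /grid_scale; field; rewrite dn0 mn0.
by congr ((1 - _ ^+ _) ^+ _); rewrite /grid_scale; field.
Qed.

Lemma measurable_gadget_count m : (0 < m)%N -> measurable_fun setT (gadget_count m).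
Proof.
move=> m0.
have -> : gadget_count m = fun w => \sum_(p <- [seq p : gadget_index m <- index_enum
    (gadget_index m) | injectiveb p.2])
    \1_(grid_gadget_event p) w.
  by apply/funext => w; rewrite big_filter.
apply: measurable_sum => p; apply: measurable_indic.
exact: measurable_grid_gadget_event.
Qed.

Lemma integral_gadget_count m (c : R) : (0 < m)%N -> 0 <= c ->
  (\int[P]_w (c * gadget_count m w)%:E)%E =
  (\sum_(p : gadget_index m | injectiveb p.2)
    c%:E * P (grid_gadget_event p))%E.
Proof.
move=> m0 c0.
under eq_integral => w _.
  rewrite /gadget_count mulr_sumr -sumEFin -big_filter; over.
have mE p := @measurable_grid_gadget_event m p m0.
rewrite ge0_integral_sum //=; last first.
- by move=> p w _; rewrite lee_fin mulr_ge0.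
- move=> p; apply/measurable_EFinP; apply: measurable_funM; first exact: measurable_cst.
  exact: measurable_indic.
rewrite big_filter; apply: eq_bigr => p _.
rewrite (@integralZl_indic _ _ _ P setT measurableT (fun=> grid_gadget_event p)) //.
  by rewrite integral_indic // setIT.
by move=> cn; move: c0; rewrite leNgt cn.
Qed.

(** With N = [m ^ d] and a = [(g / (128 * d%:R)) ^+ d], there are N cubes and at least (N/2)^(k+2)
    assignments, each filling its boxes with probability (a/N)^(k+2) and leaving the rest of the
    cell empty with probability at least 1/2. Dividing by N gives this bound. *)
Definition gadget_frequency : R := (((g / (128 * d%:R)) ^+ d / 2) ^+ k.+2) / 2.

Lemma gadget_frequency_gt0 : 0 < gadget_frequency.
Proof.
rewrite divr_gt0 // exprn_gt0 // divr_gt0 // exprn_gt0 // divr_gt0 //.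
by rewrite mulr_gt0.
Qed.

Lemma expected_gadget_count m : (0 < m)%N -> (2 * k.+2 <= m ^ d)%N ->
  (gadget_frequency%:E <= \int[P]_w (((m ^ d)%:R)^-1 * gadget_count m w)%:E)%E.
Proof.
move=> m0 mk; have mR : 0 < m%:R :> R by rewrite ltr0n.
have n0 : 0 < (m ^ d)%:R :> R by rewrite ltr0n expn_gt0 m0.
rewrite integral_gadget_count ?invr_ge0 ?ler0n //.
pose a : R := (g / (128 * d%:R)) ^+ d.
have a0 : 0 < a by rewrite exprn_gt0 // divr_gt0 // mulr_gt0.
set b : R := (1 - (2 * m%:R)^-1 ^+ d) ^+ (m ^ d - k.+2).
have nE : (m ^ d)%:R = m%:R ^+ d :> R by rewrite natrX.
rewrite (eq_bigr (fun=> (((m ^ d)%:R)^-1 * ((a / (m ^ d)%:R) ^+ k.+2 * b))%:E)); last first.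
  move=> p /injectiveP tinj; rewrite prob_grid_gadget_event // -EFinM; congr (_ * (_ ^+ _ * _))%:E.
  by rewrite expr_div_n nE.
rewrite sumEFin lee_fin sumr_const.
have -> : #|[pred p : gadget_index m | injectiveb p.2]| =
    (m ^ d * (m ^ d) ^_ k.+2)%N.
  rewrite (_ : #|_| = #|finset.setX [set: {ffun 'I_d -> 'I_m}]%SET
      [set t : {ffun 'I_k.+2 -> 'I_(m ^ d)} | injectiveb t]%SET|).
    by rewrite cardsX cardsT card_ffun card_inj_ffuns !card_ord.
  by apply: eq_card => -[j t]; rewrite !inE.
(* A cell has volume 2^(-d)/N, so Bernoulli's inequality bounds the loss by 2^(-d), at most 1/2. *)
have b2 : 1 / 2 <= b.
  have q0 : 0 <= (2 * m%:R)^-1 ^+ d :> R by rewrite exprn_ge0 // invr_ge0 mulr_ge0.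
  have nq : (m ^ d)%:R * (2 * m%:R)^-1 ^+ d <= 1 / 2 :> R.
    rewrite nE -exprMn invfM mulrCA mulfV ?lt0r_neq0 // mulr1 -[leRHS]expr1 mul1r.
    by rewrite ler_wiXn2l //; lra.
  have n1 : 1 <= (m ^ d)%:R :> R by rewrite ler1n expn_gt0 m0.
  have q1 : (2 * m%:R)^-1 ^+ d <= 1 :> R by nra.
  have := @bernoulli_sub R ((2 * m%:R)^-1 ^+ d) (m ^ d - k.+2); rewrite q0 q1 => /(_ isT).
  have : (m ^ d - k.+2)%:R <= (m ^ d)%:R :> R by rewrite ler_nat leq_subr.
  rewrite -/b; nra.
have nK : ((m ^ d)%:R / 2) ^+ k.+2 <= ((m ^ d) ^_ k.+2)%:R :> R.
  apply: (@le_trans _ _ (((m ^ d - k.+2) ^ k.+2)%:R)); last by rewrite ler_nat ffact_lower.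
  rewrite [leRHS]natrX ler_pXn2r ?nnegrE ?divr_ge0 //.
  have kn : (k.+2 <= m ^ d)%N by lia.
  by move: mk; rewrite natrB // -(ler_nat R) natrM; lra.
rewrite /gadget_frequency -/a -[leRHS]mulr_natl natrM.
move: (m ^ d)%:R n0 nK => N N0 nK.
have -> : (a / 2) ^+ k.+2 = (N / 2) ^+ k.+2 * (a / N) ^+ k.+2.
  by rewrite -exprMn; congr (_ ^+ _); field; apply: lt0r_neq0.
have aN : 0 < (a / N) ^+ k.+2 by rewrite exprn_gt0 // divr_gt0.
have N2 : 0 <= (N / 2) ^+ k.+2 by rewrite exprn_ge0 // divr_ge0 // ltW.
move: ((a / N) ^+ k.+2) ((N / 2) ^+ k.+2) (((m ^ d) ^_ k.+2)%:R : R) aN N2 nK => X Y F X0 Y0 YF.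
have -> : N * F * (N^-1 * (X * b)) = F * X * b by field; apply: lt0r_neq0.
have : Y * X <= F * X by rewrite ler_pM2r.
have : F * X * (1 / 2) <= F * X * b by rewrite ler_wpM2l // mulr_ge0 ?(le_trans Y0 YF) ?(ltW X0).
lra.
Qed.
End GadgetCount.

(** * Comparison of the constants *)

Lemma le_grid (m d : nat) : (0 < d)%N -> (m <= m.+1 ^ d)%N.
Proof.
move=> d0; apply: (leq_trans (leqnSn m)); rewrite -[leqLHS]expn1.
by rewrite leq_pexp2l.
Qed.

Section GrowthConstants.
Local Open Scope classical_set_scope.
Context (R : realType) (d : nat) (dT : measure_display) (T : measurableType dT).
Context (P : probability T R) (x : nat -> T -> 'rV[R]_d).

(** Since the total mass is 1, almost sure statements have a common witness, which [filter_ex]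
    extracts. *)
#[local] Instance ae_proper : ProperFilter (almost_everywhere P).
Proof.
apply: ae_properfilter_algebraOfSetsType.
by apply: (lt_le_trans lte01); rewrite -(probability_setT P).
Qed.

(** Along n = (m+1)^d the normalization n^((d-1)/d) is the integer power (m+1)^(d-1), and the shift
    keeps it nonzero. *)
Lemma growth_constant_grid (L : {fset 'rV[R]_d} -> R) (b : R) :
  (0 < d)%N -> growth_constant P x L b ->
  {ae P, forall w,
    (L (point_set x (m.+1 ^ d) w) / m.+1%:R ^+ d.-1) @[m --> \oo] --> b}.
Proof.
move=> d0; apply: filterS => w Lb.
have phi : (fun m => m.+1 ^ d)%N @ \oo --> \oo.
  move=> A [N _ NA]; exists N => // m /= Nm; apply: NA => /=.
  by apply: leq_trans Nm (le_grid m d0).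
rewrite [X in X @ \oo](_ : _ =
    (fun n => L (point_set x n w) / n%:R `^ ((d%:R - 1) / d%:R)) \o (fun m => m.+1 ^ d)%N).
  exact: cvg_comp phi Lb.
apply/funext => m /=; congr (_ / _).
rewrite natrX -(powR_mulrn d) // -powRrM mulrC mulfVK ?pnatr_eq0 -?lt0n //.
by rewrite -powR_mulrn // -subn1 natrB.
Qed.

Lemma growth_constant_unique (L : {fset 'rV[R]_d} -> R) (b b' : R) :
  (0 < d)%N -> growth_constant P x L b -> growth_constant P x L b' -> b = b'.
Proof.
move=> d0 Lb Lb'; have [w [h h']] := filter_ex (filterI Lb Lb').
exact: (cvg_unique (@norm_hausdorff _ _) h h').
Qed.

Lemma inv_exp_cvg0 (c : R) : (1 < d)%N -> 0 <= c -> c / m.+1%:R ^+ d.-1 @[m --> \oo] --> (0 : R).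
Proof.
move=> d1 c0; apply: (@squeeze_cvgr _ _ _ _ (cst 0) (fun m => c * harmonic m)).
- near=> m; rewrite divr_ge0 ?exprn_ge0 //= ler_wpM2l // lef_pV2 ?posrE ?exprn_gt0 ?ltr0n //.
  by rewrite -[leLHS]expr1 ler_weXn2l ?ler1n // -ltnS prednK // ltnW.
- exact: cvg_cst.
- by rewrite -[X in _ --> X](mulr0 c); apply: cvgMl_tmp; apply: cvg_harmonic.
Unshelve. all: by end_near.
Qed.

Lemma TSP_growth (bTSP b2 : R) :
  (2 <= d)%N -> iid_uniform P x -> growth_constant P x (@TSP R d) bTSP ->
  growth_constant P x (@MSTk R d 2) b2 -> bTSP = b2.
Proof.
move=> d2 hx hT h2; have d0 := ltnW d2.
(* The constants are deterministic, so a single outcome where both limits hold and all points lie in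
   the cube is enough. *)
have [w [cube [cT c2]]] := filter_ex (filterI (ae_in_cube hx)
  (filterI (growth_constant_grid d0 hT) (growth_constant_grid d0 h2))).
pose u (m : nat) : R := TSP (point_set x (m.+1 ^ d) w) / m.+1%:R ^+ d.-1 -
  MSTk 2 (point_set x (m.+1 ^ d) w) / m.+1%:R ^+ d.-1.
have u1 : u @ \oo --> bTSP - b2 by exact: cvgB.
have u0 : u @ \oo --> (0 : R).
  apply: (@squeeze_cvgr _ _ _ _ (cst 0) (fun m => d%:R / m.+1%:R ^+ d.-1)).
  - near=> m; rewrite /u /= -mulrBl.
    have M0 : 0 < m.+1%:R ^+ d.-1 :> R by rewrite exprn_gt0 // ltr0n.
    rewrite divr_ge0 ?(ltW M0) ?subr_ge0 ?MST2_le_TSP //= ler_pM2r ?invr_gt0 //.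
    rewrite lerBlDl; apply: TSP_le_MST2 => // a b.
    rewrite -[leRHS]mulr1; apply: eucl_dist_le_coord => j.
    have /point_setP[l ->] := valP a; have /point_setP[l' ->] := valP b.
    have /andP[? ?] := cube l j; have /andP[? ?] := cube l' j.
    by rewrite ler_norml; apply/andP; split; lra.
  - exact: cvg_cst.
  - exact: inv_exp_cvg0.
apply/eqP; rewrite -subr_eq0; apply/eqP.
exact: (cvg_unique (@norm_hausdorff _ _) u1 u0).
Unshelve. all: by end_near.
Qed.

Lemma MSTk_growth_separation (k : nat) (b b' : R) :
  (2 <= d)%N -> (2 <= k)%N -> (k < strict_kissing_number R d)%N -> iid_uniform P x ->
  growth_constant P x (@MSTk R d k) b -> growth_constant P x (@MSTk R d k.+1) b' ->
  b' < b.
Proof.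
move=> d2 k2 kt hx hb hb'; have d0 := ltnW d2; rewrite ltNge; apply/negP => bb'.
have [v [g [g_itv v0 v1 v2]]] := gadget_vectors d2 (ltnW k2) kt.
have g0 : 0 < g by case/andP: g_itv.
(* The proportion of gadgets among the points. *)
pose N m w := (m.+1 ^ d)%:R^-1 * gadget_count x v g m.+1 w.
have N0 m w : 0 <= N m w.
  by rewrite mulr_ge0 // /gadget_count sumr_ge0.
have N1 m w : N m w <= 1.
  rewrite ler_pdivrMl ?ltr0n ?expn_gt0 // mulr1.
  exact: gadget_count_le.
have Ncvg : {ae P, forall w, N m w @[m --> \oo] --> (0 : R)}.
  apply: filterS2 (growth_constant_grid d0 hb) (growth_constant_grid d0 hb') => w c1 c2.
  pose u (m : nat) : R := MSTk k (point_set x (m.+1 ^ d) w) / m.+1%:R ^+ d.-1 -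
  MSTk k.+1 (point_set x (m.+1 ^ d) w) / m.+1%:R ^+ d.-1.
have u1 : u @ \oo --> b - b' by exact: cvgB.
  (* Each gadget gains [g * grid_scale m.+1 / 2], which is g/(64(m+1)); division by (m+1)^(d-1)
     turns the total gain into [N m w * g / 64]. *)
  have Nu m : N m w <= 64 / g * u m.
    have := MSTk_gadget_count x d2 g_itv v0 v1 v2 w k2 (ltn0Sn m).
    rewrite /N /u /grid_scale -mulrBl -lerBrDl.
    have M0 : 0 < m.+1%:R :> R by rewrite ltr0n.
    set A := _ - _; rewrite natrX -{2}[d]prednK // exprS.
    have := exprn_gt0 d.-1 M0; move: (_ ^+ _) => D D0 h.
    rewrite ler_pdivrMl ?mulr_gt0 // mulrA (mulrC _ (64 / g)).
    have -> : 64 / g * (m.+1%:R * D) * (A / D) = 64 * m.+1%:R * A / g.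
      by field; rewrite !lt0r_neq0.
    rewrite ler_pdivlMr //; move: h.
    have -> : gadget_count x v g m.+1 w * (g * (32 * m.+1%:R)^-1 / 2) =
      gadget_count x v g m.+1 w * g / (64 * m.+1%:R) by field; rewrite lt0r_neq0.
    by rewrite ler_pdivrMr ?mulr_gt0 // (mulrC A).
  have u0 m : 0 <= u m.
    have := le_trans (N0 m w) (Nu m); rewrite pmulr_rge0 // divr_gt0 //.
  (* The limit of the nonnegative [u] is nonnegative, and the assumption [b <= b'] makes it
     nonpositive. *)
  have lim0 : b - b' = 0.
    apply/le_anti/andP; split; first by rewrite subr_le0.
    by apply: (cvgr_to_ge u1); near=> m; apply: u0.
  rewrite lim0 in u1.
  apply: (@squeeze_cvgr _ _ _ _ (cst 0) (fun m => 64 / g * u m)).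
  - by near=> m; rewrite N0 Nu.
  - exact: cvg_cst.
  - by rewrite -[X in _ --> X](mulr0 (64 / g)); apply: cvgMl_tmp.
have mN m : measurable_fun setT (EFin \o N m).
  apply/measurable_EFinP; apply: measurable_funM; first exact: measurable_cst.
  exact: (measurable_gadget_count hx).
(* The proportions are bounded by the constant 1, integrable for a probability, so their
   expectations tend to 0, against the lower bound [gadget_frequency]. *)
have [||_ _] := dominated_convergence (mu := P) measurableT mN
  (measurable_cst 0%E : measurable_fun setT (cst 0%E))
  _ (finite_measure_integrable_cst P 1 measurableT) _.
- by apply: filterS Ncvg => w cw _; apply: cvg_EFin => //; near=> m.
- by apply: nearW => w m _ /=; rewrite lee_fin ger0_norm.
rewrite integral0 => lim.
have : ((gadget_frequency d k g)%:E <= 0)%E.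
  rewrite -(cvg_lim _ lim) //; apply: lime_ge; first exact: cvgP lim.
  near=> m; apply: (expected_gadget_count hx d2 g_itv v0 v1 (ltn0Sn m)).
  apply: (@leq_trans m); first by near: m; exists (2 * k.+2)%N.
  exact: le_grid.
by rewrite lee_fin leNgt gadget_frequency_gt0.
Unshelve. all: by end_near.
Qed.
End GrowthConstants.

Theorem theorem1p2 (R : realType) (d : nat) (dT : measure_display)
    (T : measurableType dT) (P : probability T R) (x : nat -> T -> 'rV[R]_d)
    (bTSP bMST : R) (bMSTk : nat -> R)
    (hd : (2 <= d)%N)
    (hx : iid_uniform P x)
    (hTSP : growth_constant P x (@TSP R d) bTSP)
    (hMST : growth_constant P x (@MST R d) bMST)
    (hMSTk : forall k, (2 <= k)%N -> growth_constant P x (@MSTk R d k) (bMSTk k)) :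
  [/\ bTSP = bMSTk 2%N,
      forall k, (2 <= k < strict_kissing_number R d)%N -> bMSTk k > bMSTk k.+1 &
      bMSTk (strict_kissing_number R d) = bMST].
Proof.
split.
- exact: TSP_growth hd hx hTSP (hMSTk 2%N isT).
- move=> k /andP[k2 kt].
  exact: MSTk_growth_separation hd k2 kt hx (hMSTk _ k2) (hMSTk _ (leqW k2)).
- have := hMSTk _ (strict_kissing_number_ge2 R hd).
  have -> : @MSTk R d (strict_kissing_number R d) = @MST R d.
    by apply/funext => X; apply: MSTk_kissing.
  by move=> h; apply: growth_constant_unique h hMST; apply: ltnW.
Qed.
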